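(* Let $u_0\in BV(I)$ and let $u$ be the corresponding solution of $u_t=(\mathcal L(u_x))_x$ in $I_T$ with $u(\cdot,0)=u_0$, with either Dirichlet, periodic or Neumann boundary conditions. Then for almost all $t>0$ the number of facets of $u(\cdot,t)$ with curvature different from zero is finite.
   Context: Fix reals $a<b$, $T>0$, $I=(a,b)$, $I_T=I\times(0,T)$. $\operatorname{sgn}$ is the multivalued sign graph ($1$ for $p>0$, $-1$ for $p<0$, $[-1,1]$ at $p=0$), $\mathcal L(p)=\operatorname{sgn}(p+1)+\operatorname{sgn}(p-1)$, $W(p)=|p+1|+|p-1|$. For $v\in BV(I)$, $\int_I W(Dv):=|D(v+x)|(I)+|D(v-x)|(I)$. $\gamma$ denotes the trace (one-sided limit from inside $I$ at an endpoint). Solution: $u\in L^\infty(0,T;BV(I))$ with $u_t\in L^2(0,T;L^2(I))$ is a solution of $u_t=(\mathcal L(u_x))_x$ if there is $\Omega\in L^2(0,T;W^{1,2}(I))$ such that for a.e. $t$: (i) $\int_I u_t\varphi\,dx=-\int_I\Omega\varphi_x\,dx$ for all $\varphi\in C_0^\infty(I)$; (ii) $\Omega(\cdot,t)$ is a selection of $\mathcal L\circ u_x(\cdot,t)$, understood in the subdifferential sense: $\int_I W(Dv)\ge\int_I W(Du(\cdot,t))+\int_I\Omega(\cdot,t)\,d(Dv-Du(\cdot,t))$ for all $v\in BV(I)$. Then $u\in C([0,T];L^2(I))$. For given $u_0\in BV(I)$ and any one of the boundary conditions below the solution exists and is unique. Boundary conditions (for a.e. $t>0$). Neumann: $\gamma\Omega(a)=\gamma\Omega(b)=0$.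 Dirichlet data $A,B\in\mathbb R$: at $x=a$ either $\gamma u(a)=A$, or $\gamma u(a)>A$ and $\gamma\Omega(a)=2$, or $\gamma u(a)<A$ and $\gamma\Omega(a)=-2$; at $x=b$ either $\gamma u(b)=B$, or $\gamma u(b)>B$ and $\gamma\Omega(b)=-2$, or $\gamma u(b)<B$ and $\gamma\Omega(b)=2$. Periodic: the problem is posed on the circle obtained by identifying $a$ and $b$ (all function spaces, test functions, competitors and measures taken on the circle). Facets: a facet $F(\xi^-,\xi^+)$ of $u(\cdot,t)$ is the part of its graph over an interval $[\xi^-,\xi^+]$ on which $u_x(\cdot,t)\equiv p\in\{-1,1\}$ (one-sided derivatives at the endpoints), the interval being maximal with this property; $[\xi^-,\xi^+]$ is its pre-image. The facet has zero curvature if $\Omega(\xi^-,t)=\Omega(\xi^+,t)$ or, in the case of Dirichlet boundary conditions, if $\xi^-=a$ or $\xi^+=b$. *)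

(* Defs.v *)
From HB Require Import structures.
From mathcomp Require Import all_boot all_order all_algebra.
From mathcomp Require Import all_classical all_reals all_analysis.

Set Implicit Arguments.
Unset Strict Implicit.
Unset Printing Implicit Defensive.

Import Order.TTheory GRing.Theory Num.Theory.
Import numFieldNormedType.Exports.

Local Open Scope classical_set_scope.
Local Open Scope ring_scope.

(* Functions of time and space are written [u t x].  Elements of Lebesgue,
   Sobolev and BV spaces are represented by real functions, taken up to
   equality almost everywhere on I = ]a, b[. *)

Inductive boundary_condition (R : realType) :=
| Dirichlet of R & R
| Neumann
| Periodic.
Arguments Neumann {R}.
Arguments Periodic {R}.

Section charges.
Context {R : realType}.
Local Notation mR := (measurableTypeR R).
Implicit Types (nu : {charge set mR -> \bar R}) (X : set R) (f : R -> R).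

Definition hahn_pos nu : set mR := projT1 (cid (Hahn_decomposition nu)).

Definition hahn_neg nu : set mR :=
  projT1 (cid (projT2 (cid (Hahn_decomposition nu)))).

Definition hahnP nu : hahn_decomposition nu (hahn_pos nu) (hahn_neg nu) :=
  projT2 (cid (projT2 (cid (Hahn_decomposition nu)))).

(* |nu|(X) *)
Definition variation_on nu X : \bar R := charge_variation (hahnP nu) X.

Definition charge_integral nu X f : \bar R :=
  (\int[jordan_pos (hahnP nu)]_(x in X) (f x)%:E
   - \int[jordan_neg (hahnP nu)]_(x in X) (f x)%:E)%E.

End charges.

Section spaces.
Context {R : realType}.
Local Notation mR := (measurableTypeR R).
Local Notation mu := (@lebesgue_measure R).
Variables (a b : R) (bc : boundary_condition R).
Local Notation I := `]a, b[%classic.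
Implicit Types (v f g phi : R -> R) (nu : {charge set mR -> \bar R}).

(* Set carrying the measures: I, or, for the circle obtained by identifying a
   and b, the half-open interval [a, b[, whose point a is the gluing point. *)
Definition domain : set R :=
  if bc is Periodic then `[a, b[%classic else `]a, b[%classic.

Definition period : R := b - a.

Definition periodic f : Prop := forall x, f (x + period) = f x.

(* The (b - a)-periodic function coinciding with [f] on [a, b[. *)
Definition periodize f (x : R) : R :=
  f (x - period * (Num.floor ((x - a) / period))%:~R).

Definition smooth phi : Prop :=
  forall (n : nat) (x : R), derivable (derive1n n phi) x 1.

Definition compactly_supported (c d : R) phi : Prop :=
  exists y z, [/\ c < y, z < d & forall x, ~~ (y <= x <= z) -> phi x = 0].

(* C_0^oo(I), or C^oo of the circle. *)
Definition test_function phi : Prop :=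
  smooth phi /\ if bc is Periodic then periodic phi
                else compactly_supported a b phi.

Definition integrable_on_I f : Prop := mu.-integrable I (EFin \o f).

(* [nu] is the distributional derivative of [v], as a signed measure. *)
Definition is_derivative_charge v nu : Prop :=
  (forall A : set R, measurable A -> nu A = nu (A `&` domain)) /\
  forall phi, test_function phi ->
    (\int[mu]_(x in I) (v x * derive1 phi x)%:E
     = - charge_integral nu domain phi)%E.

Definition BV v : Prop :=
  integrable_on_I v /\ exists nu, is_derivative_charge v nu.

(* Dv, for v in BV. *)
Definition derivative_charge v : {charge set mR -> \bar R} :=
  if pselect (exists nu, is_derivative_charge v nu) is left ex
  then projT1 (cid ex) else czero.

Definition BV_norm v : \bar R :=
  (\int[mu]_(x in I) `|v x|%:E
   + variation_on (derivative_charge v) domain)%E.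

Lemma measurable_domain : measurable (domain : set mR).
Proof. by rewrite /domain; case: bc => *; exact: measurable_itv. Qed.

Lemma domain_fin : (mu domain < +oo)%E.
Proof.
by rewrite /domain; case: bc => *; rewrite lebesgue_measure_itv /=;
  case: ifP => // _; rewrite -EFinB ltry.
Qed.

Definition lebesgue_charge : {charge set mR -> \bar R} :=
  charge_of_finite_measure (mfrestr measurable_domain domain_fin).

(* D(v + c x).  On the circle the function c x is multivalued, but its
   derivative is the measure c dx. *)
Definition derivative_charge_shift (c : R) v : {charge set mR -> \bar R} :=
  if bc is Periodic
  then cadd (derivative_charge v) (cscale c lebesgue_charge)
  else derivative_charge (fun x => v x + c * x).

(* \int_I W(Dv) = |D(v + x)|(I) + |D(v - x)|(I) *)
Definition W_energy v : \bar R :=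
  (variation_on (derivative_charge_shift 1 v) domain
   + variation_on (derivative_charge_shift (-1) v) domain)%E.

(* [g] is the continuous representative, up to the boundary, of [f]; on the
   circle it is given as a periodic function on the line. *)
Definition continuous_representative f g : Prop :=
  {ae mu, forall x, I x -> g x = f x} /\
  if bc is Periodic then continuous g /\ periodic g
  else {within `[a, b], continuous g}.

(* The value at an atom of Dv - Dw is that of the continuous representative. *)
Definition subdifferential_selection w f : Prop :=
  exists g, continuous_representative f g /\
    forall v, BV v ->
      (W_energy w
       + charge_integral
           (cadd (derivative_charge v) (copp (derivative_charge w))) domain g
       <= W_energy v)%E.

Definition weak_derivative f g : Prop :=
  forall phi, test_function phi ->
    (\int[mu]_(x in I) (f x * derive1 phi x)%:E
     = - \int[mu]_(x in I) (g x * phi x)%:E)%E.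

Definition trace_left_end f (l : R) : Prop :=
  exists g, {ae mu, forall x, I x -> g x = f x} /\ g x @[x --> a^'+] --> l.

Definition trace_right_end f (l : R) : Prop :=
  exists g, {ae mu, forall x, I x -> g x = f x} /\ g x @[x --> b^'-] --> l.

Definition boundary_conditions w f : Prop :=
  match bc with
  | Neumann => trace_left_end f 0 /\ trace_right_end f 0
  | Dirichlet A B =>
      (exists l, trace_left_end w l /\
         [\/ l = A, l > A /\ trace_left_end f 2
           | l < A /\ trace_left_end f (-2)]) /\
      (exists l, trace_right_end w l /\
         [\/ l = B, l > B /\ trace_right_end f (-2)
           | l < B /\ trace_right_end f 2])
  | Periodic => True (* encoded in the spaces on the circle *)
  end.

(* [v] has a representative on [y, z] with derivative p throughout, one-sided
   at y and z. *)
Definition has_slope v (p y z : R) : Prop :=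
  exists w : R -> R,
    [/\ {ae mu, forall x, `]y, z[%classic x -> w x = v x},
        forall x, `]y, z[%classic x -> is_derive x 1 w p,
        (h^-1 * (w (y + h) - w y)) @[h --> 0^'+] --> p
      & (h^-1 * (w (z + h) - w z)) @[h --> 0^'-] --> p].

Definition slope_interval v (p y z : R) : Prop :=
  y < z /\ if bc is Periodic then has_slope (periodize v) p y z
           else [/\ a <= y, z <= b & has_slope v p y z].

(* [y, z] is the pre-image of a facet.  On the circle it is an interval of the
   universal cover, normalised modulo the period by y \in [a, b[. *)
Definition facet v (y z : R) : Prop :=
  exists2 p : R, p = 1 \/ p = -1 &
    [/\ slope_interval v p y z,
        forall y' z', slope_interval v p y' z' -> y' <= y -> z <= z' ->
          y' = y /\ z' = z
      & if bc is Periodic then a <= y < b else True].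

Definition zero_curvature f (y z : R) : Prop :=
  (exists g, continuous_representative f g /\ g y = g z) \/
  (if bc is Dirichlet _ _ then y = a \/ z = b else False).

End spaces.

Section solutions.
Context {R : realType}.
Local Notation mu := (@lebesgue_measure R).
Variables (a b T : R) (bc : boundary_condition R).
Local Notation I := `]a, b[%classic.
Local Notation J := `]0, T[%classic.
Implicit Types (u w Om : R -> R -> R).

Definition jointly_measurable w : Prop :=
  measurable_fun (J `*` I) (fun z : R * R => w z.1 z.2).

(* L^2(0,T;L^2(I)), identified with L^2 of the space-time cylinder. *)
Definition L2_L2 w : Prop :=
  jointly_measurable w /\
  (\int[mu \x mu]_(z in J `*` I) (`|w z.1 z.2| ^+ 2)%:E < +oo)%E.

Definition Linfty_BV u : Prop :=
  jointly_measurable u /\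
  exists M : R, {ae mu, forall t, J t ->
    BV a b bc (u t) /\ (BV_norm a b bc (u t) <= M%:E)%E}.

Definition L2_W12 Om : Prop :=
  L2_L2 Om /\
  exists Omx, L2_L2 Omx /\
    {ae mu, forall t, J t -> weak_derivative a b bc (Om t) (Omx t)}.

(* Weak derivative of t |-> u t as an L^2(I)-valued function. *)
Definition time_derivative u ut : Prop :=
  forall eta : R -> R, smooth eta -> compactly_supported 0 T eta ->
    {ae mu, forall x, I x ->
      (\int[mu]_(t in J) (u t x * derive1 eta t)%:E
       = - \int[mu]_(t in J) (ut t x * eta t)%:E)%E}.

(* [u] is a solution and [Om] is an associated flux. *)
Definition solution u Om : Prop :=
  [/\ Linfty_BV u,
      exists ut, [/\ L2_L2 ut, time_derivative u ut
        & {ae mu, forall t, J t -> forall phi, test_function a b bc phi ->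
            (\int[mu]_(x in I) (ut t x * phi x)%:E
             = - \int[mu]_(x in I) (Om t x * derive1 phi x)%:E)%E}],
      L2_W12 Om,
      {ae mu, forall t, J t -> subdifferential_selection a b bc (u t) (Om t)}
    & {ae mu, forall t, J t -> boundary_conditions a b bc (u t) (Om t)}].

Definition C_L2 w : Prop :=
  (forall t, 0 <= t <= T ->
     measurable_fun I (w t) /\
     (\int[mu]_(x in I) (`|w t x| ^+ 2)%:E < +oo)%E) /\
  forall t, 0 <= t <= T ->
    (\int[mu]_(x in I) (`|w s x - w t x| ^+ 2)%:E)%E
      @[s --> within `[0, T]%classic (nbhs t)] --> 0%E.

(* The value at time 0 is that of the representative in C([0,T];L^2(I)). *)
Definition initial_value u (u0 : R -> R) : Prop :=
  exists w, [/\ C_L2 w,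
    {ae mu, forall t, J t -> {ae mu, forall x, I x -> w t x = u t x}}
    & {ae mu, forall x, I x -> w 0 x = u0 x}].

End solutions.

(* Main.v *)
(* Fix a time at which the selection inequality holds, put nu = Du and let g be
   the continuous representative of the flux, shifted by a suitable constant in
   the periodic case.  Testing the inequality with the
   competitor whose derivative is k dx on a set N and nu elsewhere shows, for
   p = 1 or p = -1:
   - if 0 < p g < 2 near a point, then nu = p dx there, that is, the point is
     interior to an interval on which u has slope p;
   - if nu = p dx on an interval, then 0 <= p g <= 2 there.
   By maximality p g is thus 0 or 2 at the ends of an interior facet of slope p,
   and if its curvature is not zero then g oscillates by 2 over the facet.  As g
   is uniformly continuous such facets have length bounded below, and facets of
   the same slope do not overlap. *)
Require Import Defs.
From mathcomp Require Import all_boot all_order all_algebra.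
From mathcomp Require Import all_classical all_reals all_analysis.
From mathcomp Require Import measurable_realfun ring lra.

Set Implicit Arguments.
Unset Strict Implicit.
Unset Printing Implicit Defensive.

Import Order.TTheory GRing.Theory Num.Theory.
Import numFieldNormedType.Exports.

Local Open Scope classical_set_scope.
Local Open Scope ring_scope.

(** * Smooth cutoffs *)

Section smooth_functions.
Context {R : realType}.
Implicit Types (f g phi : R -> R) (n k : nat) (x y c : R).

(** Both tests rest on the convex function k -> W(k) - q k. The subdifferential of W is [0, 2] at 1
    and [-2, 0] at -1, so p is a minimiser exactly when 0 <= p q <= 2, and the only one when both
    inequalities are strict. The flux is not constant on N: its value q at a point is frozen, at the
    price of an error e times a total variation. Strictness absorbs this error in the first test; in
    the second, e tends to 0. The obstacle is that the hypothesis compares functions, while the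
    tests prescribe measures. A competitor has to be exhibited as a BV function with a given
    derivative, and [derivative_charge] is picked by choice among the charges satisfying the
    integration by parts formula. Hence the preparation: a charge is the derivative of its
    cumulative function (Fubini), and a BV function determines its derivative charge (du
    Bois-Reymond, with explicit cutoffs built from exp(-1/x)). On the circle, changing nu on N alone
    alters the total mass, which no derivative can do; this is what forces the shift of the flux. *)

Fixpoint diffn n f : Prop :=
  if n is m.+1 then
    exists2 f', (forall x, is_derive x (1 : R) f (f' x)) & diffn m f'
  else True.

Lemma derive1_is_derive f f' :
  (forall x, is_derive x (1 : R) f (f' x)) -> derive1 f = f'.
Proof. by move=> ff'; apply/funext => x; rewrite derive1E (@derive_val _ _ _ _ _ _ _ (ff' x)). Qed.

(** [diffn n] carries each derivative as a witness, so its stability under products, inverses and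
    compositions is an induction on [n]; no iterated [derive1n] of a compound function is ever
    computed. *)
Lemma smooth_diffn f : smooth f <-> forall n, diffn n f.
Proof.
split=> [sf n|df n x].
  have : forall n x, derivable (derive1n n f) x 1 by exact: sf.
  elim: n f {sf} => // n IHn f sf; exists (derive1 f).
    by move=> x; rewrite derive1E; apply: derivableP; exact: (sf 0%N).
  by apply: IHn => m x; rewrite -derive1Sn.
have [f' ff' _] : diffn 1 (derive1n n f); last exact: (@ex_derive _ _ _ _ _ _ _ (ff' x)).
suff {x} : forall m, diffn m (derive1n n f) by apply.
elim: n => // n IHn m; have [f' ff' dm] := IHn m.+1.
by rewrite derive1nS (derive1_is_derive ff').
Qed.

Lemma diffnW n f : diffn n.+1 f -> diffn n f.
Proof.
elim: n f => // n IHn f [f' ff' df']; exists f' => //; exact: IHn.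
Qed.

Lemma diffn_cst n c : diffn n (fun=> c).
Proof. by elim: n c => // n IHn c; exists (fun=> 0) => // x; exact: is_derive_cst. Qed.

Lemma diffn_id n : diffn n id.
Proof.
by case: n => // n; exists (fun=> 1); [move=> x; exact: is_derive_id|exact: diffn_cst].
Qed.

Lemma diffnD n f g : diffn n f -> diffn n g -> diffn n (fun x => f x + g x).
Proof.
elim: n f g => // n IHn f g [f' ff' df'] [g' gg' dg'].
exists (fun x => f' x + g' x); last exact: IHn.
by move=> x; exact: is_deriveD.
Qed.

Lemma diffnM n f g : diffn n f -> diffn n g -> diffn n (fun x => f x * g x).
Proof.
elim: n f g => // n IHn f g df dg.
have [f' ff' df'] := df; have [g' gg' dg'] := dg.
exists (fun x => f x * g' x + g x * f' x); first by move=> x; exact: is_deriveM.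
by apply: diffnD; apply: IHn => //; exact: diffnW.
Qed.

Lemma diffnZ n c f : diffn n f -> diffn n (fun x => c * f x).
Proof. by apply: diffnM; exact: diffn_cst. Qed.

Lemma diffnB n f g : diffn n f -> diffn n g -> diffn n (fun x => f x - g x).
Proof.
move=> df dg; rewrite [X in diffn n X](_ : _ = fun x => f x + (-1) * g x).
  by apply: diffnD => //; exact: diffnZ.
by apply/funext => x; rewrite mulN1r.
Qed.

Lemma diffn_comp n f g : diffn n f -> diffn n g -> diffn n (fun x => f (g x)).
Proof.
elim: n f g => // n IHn f g [f' ff' df'] dg; have [g' gg' dg'] := dg.
exists (fun x => f' (g x) * g' x).
  by move=> x; have := ff' (g x) => fgx; exact: is_derive1_comp.
by apply: diffnM => //; apply: IHn => //; exact: diffnW.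
Qed.

Lemma diffnV n f : (forall x, f x != 0) -> diffn n f -> diffn n (fun x => (f x)^-1).
Proof.
move=> f0; elim: n => // n IHn df; have dV := IHn (diffnW df).
have [f' ff' df'] := df.
exists (fun x => -1 * (((f x)^-1 * (f x)^-1) * f' x)).
  move=> x; apply: (is_derive_eq (is_deriveV (f0 x) (ff' x))).
  by rewrite mulN1r expr2 invfM scaleNr.
by apply: diffnZ; apply: diffnM => //; exact: diffnM.
Qed.

Lemma diffn_affine n c x : diffn n (fun y => c * (y - x)).
Proof. by apply: diffnZ; apply: diffnB; [exact: diffn_id|exact: diffn_cst]. Qed.

(* The span of this family is closed under differentiation, also at [0]. *)
Definition flat k x : R := if 0 < x then x^-1 ^+ k * expR (- x^-1) else 0.

(** The term of order k + 2 in the exponential series at 1/x beats the factor x^-k by x^2, which is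
    enough for differentiability at 0 with derivative 0. *)
Lemma flat_le k x : `|flat k x| <= k.+2`!%:R * x ^+ 2.
Proof.
rewrite /flat; case: ifPn => x0; last by rewrite normr0 mulr_ge0 ?sqr_ge0.
rewrite ger0_norm ?mulr_ge0 ?exprn_ge0 ?invr_ge0 ?expR_ge0 ?(ltW x0)//.
have xV0 : 0 <= x^-1 by rewrite invr_ge0 ltW.
have : x^-1 ^+ k.+2 / k.+2`!%:R <= expR x^-1.
  by rewrite (le_trans _ (expR_ge1Dxn k.+1 xV0))// lerDr.
rewrite ler_pdivrMr ?ltr0n ?fact_gt0// => h.
rewrite expRN ler_pdivrMr ?expR_gt0//.
have -> : x^-1 ^+ k = x^-1 ^+ k.+2 * x ^+ 2.
  by rewrite !exprS expr0; field; rewrite gt_eqF.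
by rewrite [leRHS]mulrAC ler_wpM2r ?sqr_ge0// (le_trans h)// mulrC.
Qed.

Lemma is_derive_quadratic f c :
  (forall x, `|f x| <= c * x ^+ 2) -> is_derive (0 : R) (1 : R) f 0.
Proof.
move=> fle.
have f0 : f 0 = 0 by apply/eqP; have := fle 0; rewrite expr0n mulr0 normr_le0.
have c0 : 0 <= c by have := fle 1; rewrite expr1n mulr1; exact: le_trans.
suff cv : h^-1 *: (f (h *: (1 : R) + 0) - f 0) @[h --> (0 : R)^'] --> (0 : R).
  by apply: DeriveDef; [apply/cvg_ex; exists 0|exact/cvg_lim].
apply/cvgr0Pnorm_le => e e0; near=> h.
have h0 : h != 0 by near: h; exact: nbhs_dnbhs_neq.
rewrite f0 subr0 addr0 normrM normfV ler_pdivrMl ?normr_gt0//.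
rewrite [h *: _]mulr1 (le_trans (fle h))// -(real_normK (num_real h)) expr2 mulrCA.
rewrite ler_wpM2l//.
have : `|h| <= e / (c + 1).
  near: h; by apply: dnbhs0_le; rewrite divr_gt0// ltr_wpDl.
rewrite ler_pdivlMr ?ltr_wpDl// => /(le_trans _); apply.
by rewrite mulrC ler_wpM2l// lerDl.
Unshelve. all: by end_near. Qed.

Lemma is_derive_flat k x :
  is_derive x (1 : R) (flat k) (- k%:R * flat k.+1 x + flat k.+2 x).
Proof.
have [x0|x0|->] := ltgtP x 0.
- have -> : - k%:R * flat k.+1 x + flat k.+2 x = 0.
    by rewrite /flat !ltNge (ltW x0)/= mulr0 addr0.
  apply: (@near_eq_is_derive _ _ _ (fun=> (0 : R))).
  by near=> y; rewrite /flat ltNge ifN// negbK ltW//; near: y; exact: lt_nbhsl.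
- rewrite /flat x0.
  apply: (@near_eq_is_derive _ _ _ (fun x => x^-1 ^+ k * expR (- x^-1))).
    by near=> y; rewrite ifT//; near: y; exact: lt_nbhsr.
  have xn0 : x != 0 by rewrite gt_eqF.
  have dV : is_derive x (1 : R) (fun x => x^-1) (- x ^- 2).
    by apply: (is_derive_eq (is_deriveV xn0 (is_derive_id x (1 : R)))); rewrite [_ *: _]mulr1.
  have dE : is_derive x (1 : R) (fun x => expR (- x^-1)) (expR (- x^-1) * x ^- 2).
    have dN : is_derive x (1 : R) (fun x => - x^-1) (x ^- 2).
      by apply: (is_derive_eq (is_deriveN dV)); rewrite opprK.
    have de : is_derive (- x^-1) (1 : R) expR (expR (- x^-1)) by exact: is_derive_expR.
    exact: is_derive1_comp.
  have := is_deriveX k dV; rewrite exprfctE => dX.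
  apply: (is_derive_eq (is_deriveM dX dE)).
  move: (expR _) => e; clear dX; rewrite /GRing.scale/=.
  case: k => [|k]/=; first by field.
  by rewrite !exprS; move: (x^-1 ^+ k) => y; field.
- rewrite /flat !ltxx mulr0 addr0; apply: (is_derive_quadratic (@flat_le k)).
Unshelve. all: by end_near. Qed.

Lemma diffn_flat n k : diffn n (flat k).
Proof.
elim: n k => // n IHn k; exists (fun x => - k%:R * flat k.+1 x + flat k.+2 x).
  by move=> x; exact: is_derive_flat.
by apply: diffnD => //; exact: diffnZ.
Qed.

Lemma flat0_gt0 x : 0 < x -> 0 < flat 0 x.
Proof. by move=> x0; rewrite /flat x0 expr0 mul1r expR_gt0. Qed.

Lemma flat_ge0 k x : 0 <= flat k x.
Proof.
rewrite /flat; case: ifP => // x0.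
by rewrite mulr_ge0 ?exprn_ge0 ?invr_ge0 ?expR_ge0// ltW.
Qed.

(** The classical smooth transition from 0 to 1 on [0, 1]; the denominator never vanishes because x
    and 1 - x are not both nonpositive. *)
Definition smooth_step x : R := flat 0 x / (flat 0 x + flat 0 (1 - x)).

Lemma flat_step_gt0 x : 0 < flat 0 x + flat 0 (1 - x).
Proof.
have [x0|x0] := ltP 0 x; first by rewrite ltr_wpDr ?flat_ge0 ?flat0_gt0.
by rewrite ltr_wpDl ?flat_ge0 ?flat0_gt0// subr_gt0 (le_lt_trans x0).
Qed.

Lemma smooth_step_le0 x : x <= 0 -> smooth_step x = 0.
Proof. by move=> x0; rewrite /smooth_step /flat ltNge x0 mul0r. Qed.

Lemma smooth_step_ge1 x : 1 <= x -> smooth_step x = 1.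
Proof.
move=> x1; rewrite /smooth_step [flat 0 (1 - x)]/flat ltNge subr_le0 x1/=.
by rewrite addr0 divff// gt_eqF// flat0_gt0// (lt_le_trans _ x1).
Qed.

Lemma diffn_smooth_step n : diffn n smooth_step.
Proof.
apply: diffnM; first exact: diffn_flat.
apply: diffnV => [x|]; first by rewrite gt_eqF// flat_step_gt0.
apply: diffnD; first exact: diffn_flat.
apply: (diffn_comp (diffn_flat _ _)).
by apply: diffnB; [exact: diffn_cst|exact: diffn_id].
Qed.

Lemma smooth_is_derive f x : smooth f -> is_derive x (1 : R) f (derive1 f x).
Proof. by move=> sf; rewrite derive1E; apply: derivableP; exact: (sf 0%N). Qed.

Lemma smooth_derive1 f : smooth f -> smooth (derive1 f).
Proof. by move=> sf n x; rewrite -derive1Sn; exact: (sf n.+1). Qed.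

Lemma smooth_continuous f : smooth f -> continuous f.
Proof.
move=> sf x; apply/differentiable_continuous/derivable1_diffP.
exact: (sf 0%N).
Qed.

Lemma smooth_derive1_continuous f : smooth f -> continuous (derive1 f).
Proof. by move=> /smooth_derive1; exact: smooth_continuous. Qed.

Lemma continuous_measurable f (D : set R) :
  continuous f -> measurable_fun (D : set (measurableTypeR R)) f.
Proof.
by move=> cf; apply: measurable_funTS; exact: continuous_measurable_fun.
Qed.

(* A primitive of the approximate Heaviside function in closed form, so that no
   integration is needed to build test functions. *)
Definition ramp x : R := x * smooth_step x.

Definition heaviside x : R := derive1 ramp x.

Lemma smooth_smooth_step : smooth (@smooth_step).
Proof. by apply/smooth_diffn => n; exact: diffn_smooth_step. Qed.

Lemma diffn_ramp n : diffn n ramp.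
Proof. by apply: diffnM; [exact: diffn_id|exact: diffn_smooth_step]. Qed.

Lemma smooth_ramp : smooth ramp.
Proof. by apply/smooth_diffn => n; exact: diffn_ramp. Qed.

Lemma heavisideE x : heaviside x = smooth_step x + x * derive1 smooth_step x.
Proof.
have dS := smooth_is_derive x smooth_smooth_step.
have := is_deriveM (is_derive_id x (1 : R)) dS => dM.
rewrite /heaviside derive1E (@derive_val _ _ _ _ _ _ _ dM) addrC.
by rewrite /GRing.scale/= mulr1.
Qed.

Lemma heaviside_le0 x : x <= 0 -> heaviside x = 0.
Proof.
rewrite le_eqVlt heavisideE => /predU1P[->|x0].
  by rewrite smooth_step_le0// mul0r addr0.
rewrite (smooth_step_le0 (ltW x0)) derive1E.
rewrite (@near_eq_derive _ _ _ _ (fun=> (0 : R))) ?derive_cst ?mulr0 ?addr0//.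
near=> y; rewrite smooth_step_le0// ltW//; near: y; exact: lt_nbhsl.
Unshelve. all: by end_near. Qed.

Lemma heaviside_gt1 x : 1 < x -> heaviside x = 1.
Proof.
move=> x1; rewrite heavisideE (smooth_step_ge1 (ltW x1)) derive1E.
rewrite (@near_eq_derive _ _ _ _ (fun=> (1 : R))) ?derive_cst ?mulr0 ?addr0//.
near=> y; rewrite smooth_step_ge1// ltW//; near: y; exact: lt_nbhsr.
Unshelve. all: by end_near. Qed.

Lemma continuous_heaviside : continuous heaviside.
Proof. exact: smooth_derive1_continuous smooth_ramp. Qed.

(** [heaviside] does not stay below 1: it vanishes at 0 and has integral 1 over [0, 1]. A bound by
    compactness is all that dominated convergence requires. *)
Lemma heaviside_bounded : exists M, forall x, `|heaviside x| <= M.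
Proof.
have ch : {within `[(0 : R), 1], continuous (fun x => `|heaviside x|)}.
  apply: continuous_subspaceT => x.
  by apply: continuous_comp; [exact: continuous_heaviside|exact: norm_continuous].
have [c _ hc] := EVT_max ler01 ch.
exists (`|heaviside c| + 1) => x.
have [x0|x0] := leP x 0; first by rewrite heaviside_le0// normr0 addr_ge0.
have [x1|x1] := ltP 1 x; first by rewrite heaviside_gt1// normr1 lerDr.
by rewrite (le_trans (hc x _)) ?lerDl// in_itv/= (ltW x0).
Qed.

End smooth_functions.

(** * The du Bois-Reymond lemma *)

Section du_bois_reymond.
Context {R : realType}.
Local Notation mR := (measurableTypeR R).
Local Notation mu := (@lebesgue_measure R).
Implicit Types (f g h phi : R -> R) (a b x y z : R) (n : nat).

Lemma integrable_mul_bounded (d : measure_display) (T : measurableType d)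
    (m : {measure set T -> \bar R}) (D : set T) (f h : T -> R) (M : R) :
  measurable D -> m.-integrable D (EFin \o f) -> measurable_fun D h ->
  (forall t, D t -> `|h t| <= M) ->
  m.-integrable D (EFin \o (fun t => f t * h t)).
Proof.
move=> mD fi mh hM.
rewrite (_ : EFin \o _ = (EFin \o f) \* (EFin \o h))%E; last exact/funext.
apply: integrableMl => //; exists M; split; first exact: num_real.
by move=> N MN x Dx /=; rewrite (le_trans (hM x Dx))// ltW.
Qed.

Lemma is_derive_comp_affine f (df : R) (m c x : R) :
  is_derive (m * (x - c)) (1 : R) f df ->
  is_derive x (1 : R) (fun y => f (m * (y - c))) (df * m).
Proof.
move=> dfx.
have dg : is_derive x (1 : R) (fun y => m * (y - c)) m.
  have dB : is_derive x (1 : R) (fun y => y - c) 1.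
    by apply: (is_derive_eq (is_deriveB (is_derive_id x (1 : R)) (is_derive_cst c x 1))); rewrite subr0.
  apply: (is_derive_eq (is_deriveZ m dB)); exact: mulr1.
exact: (@is_derive1_comp R f (fun y => m * (y - c)) x df m).
Qed.

Lemma ramp_le0 x : x <= 0 -> ramp x = 0.
Proof. by move=> x0; rewrite /ramp smooth_step_le0// mulr0. Qed.

Lemma ramp_ge1 x : 1 <= x -> ramp x = x.
Proof. by move=> x0; rewrite /ramp smooth_step_ge1// mulr1. Qed.

Section test.
Variables (a b c d m : R).
Hypotheses (ac : a < c) (cd : c < d) (m0 : 0 < m) (db : d + m^-1 < b).

(** With these values the transition of [smooth_step (l * (x - r))] occupies the middle third of ]a,
    b[. *)
Let l := 3 / (b - a).
Let r := (2 * a + b) / 3.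

(** The two ramps form a smoothed primitive of the indicator of ]c, d], which passes from 0 to d -
    c. A fixed step of the same height is subtracted, so that the result vanishes again near b and
    is a legitimate test function. *)
Definition trapezoid x : R :=
  m^-1 * ramp (m * (x - c)) - m^-1 * ramp (m * (x - d))
  - (d - c) * smooth_step (l * (x - r)).

Definition trapezoid' x : R :=
  heaviside (m * (x - c)) - heaviside (m * (x - d))
  - (d - c) * (derive1 smooth_step (l * (x - r)) * l).

Lemma is_derive_trapezoid x : is_derive x (1 : R) trapezoid (trapezoid' x).
Proof.
have dc := is_deriveZ m^-1 (is_derive_comp_affine (smooth_is_derive (m * (x - c)) (@smooth_ramp R))).
have dd := is_deriveZ m^-1 (is_derive_comp_affine (smooth_is_derive (m * (x - d)) (@smooth_ramp R))).
have ds := is_deriveZ (d - c) (is_derive_comp_affine (smooth_is_derive (l * (x - r)) (@smooth_smooth_step R))).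
apply: (is_derive_eq (is_deriveB (is_deriveB dc dd) ds)).
by rewrite /trapezoid' /heaviside /GRing.scale/=; field; rewrite gt_eqF.
Qed.

Lemma smooth_trapezoid : smooth trapezoid.
Proof.
apply/smooth_diffn => n; apply: diffnB; first apply: diffnB; apply: diffnZ.
- exact: (diffn_comp (diffn_ramp _) (diffn_affine _ _ _)).
- exact: (diffn_comp (diffn_ramp _) (diffn_affine _ _ _)).
- exact: (diffn_comp (diffn_smooth_step _) (diffn_affine _ _ _)).
Qed.

Lemma compactly_supported_trapezoid : compactly_supported a b trapezoid.
Proof.
move: (ac) (cd) (db) => ac' cd' db'.
have mV0 : 0 < m^-1 by rewrite invr_gt0.
have ab : 0 < b - a.
  by rewrite subr_gt0 (lt_trans ac)// (lt_trans cd)// (lt_trans _ db)// ltrDl.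
have l0 : 0 < l by rewrite /l divr_gt0.
have lV : l^-1 = (b - a) / 3 by rewrite /l invf_div.
have lV0 : 0 < l^-1 by rewrite invr_gt0.
exists (Num.min c r), (Num.max (d + m^-1) (r + l^-1)); split.
- by rewrite lt_min ac /r; lra.
- by rewrite gt_max db lV /r; lra.
move=> x; rewrite negb_and -!ltNge => /orP[|].
  rewrite lt_min => /andP[xc xr]; rewrite /trapezoid !ramp_le0 ?smooth_step_le0.
  + by rewrite !mulr0 !subr0.
  + by rewrite pmulr_rle0// subr_le0 ltW.
  + by rewrite pmulr_rle0//; lra.
  + by rewrite pmulr_rle0// subr_le0 ltW.
rewrite gt_max => /andP[xd xr]; rewrite /trapezoid !ramp_ge1 ?smooth_step_ge1.
+ by field; rewrite gt_eqF.
+ by rewrite -ler_pdivrMl// mulr1; lra.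
+ by rewrite -ler_pdivrMl// mulr1; lra.
+ by rewrite -ler_pdivrMl// mulr1; lra.
Qed.

End test.

Lemma near_ltr_nat y : \forall n \near \oo, y < n.+1%:R.
Proof.
near=> n; apply: (@lt_trans _ _ n%:R); last by rewrite ltr_nat.
by near: n; exact: nbhs_infty_gtr.
Unshelve. all: by end_near. Qed.

(** At x = c the limit is 0, since [heaviside] vanishes at 0; this is why the intervals obtained
    below are of the form ]c, d]. *)
Lemma heaviside_cvg (c x : R) :
  heaviside (n.+1%:R * (x - c)) @[n --> \oo] --> ((c < x)%R%:R : R).
Proof.
apply: cvg_near_cst; near=> n.
have [xc|cx] := leP x c.
  by rewrite heaviside_le0// pmulr_rle0 ?ltr0n// subr_le0.
rewrite heaviside_gt1// -ltr_pdivrMr ?subr_gt0// mul1r.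
by near: n; exact: near_ltr_nat.
Unshelve. all: by end_near. Qed.

(** [K] is the integral of [f] against the derivative of the fixed step in [trapezoid], hence
    independent of c and d. Testing with trapezoids of increasing steepness yields the integral over
    ]c, d] by dominated convergence. *)
Lemma du_bois_reymond_itv a b f : a < b -> integrable_on_I a b f ->
  (forall phi, smooth phi -> compactly_supported a b phi ->
    (\int[mu]_(x in `]a, b[) (f x * derive1 phi x)%:E = 0)%E) ->
  exists K, forall c d, a < c -> c < d -> d < b ->
    \int[mu]_(x in `]c, d]) f x = (d - c) * K.
Proof.
move=> ab fi f0; set I := `]a, b[%classic.
have mI : measurable (I : set mR) by exact: measurable_itv.
pose l := 3 / (b - a); pose r := (2 * a + b) / 3.
pose s x : R := derive1 smooth_step (l * (x - r)) * l.
have cs : continuous s.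
  move=> x; apply: cvgM; last exact: cvg_cst.
  apply: (@continuous_comp _ _ _ (fun x => l * (x - r))).
    by apply: cvgM; [exact: cvg_cst|apply: cvgB; [exact: cvg_id|exact: cvg_cst]].
  exact: smooth_derive1_continuous (@smooth_smooth_step R) _.
have [C sC] : exists C, forall x, I x -> `|s x| <= C.
  have cns : {within `[a, b], continuous (fun x => `|s x|)}.
    apply: continuous_subspaceT => x.
    by apply: continuous_comp; [exact: cs|exact: norm_continuous].
  have [e _ he] := EVT_max (ltW ab) cns.
  by exists `|s e| => x; rewrite /I/= in_itv/= => /andP[? ?]; apply: he; rewrite in_itv/= !ltW.
have ifs : mu.-integrable I (EFin \o (fun x => f x * s x)).
  by apply: (@integrable_mul_bounded _ _ _ _ _ _ C) => //; exact: continuous_measurable.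
exists (\int[mu]_(x in I) (f x * s x)) => c d ac cd db.
have [M HM] := @heaviside_bounded R.
pose k n x : R := heaviside (n.+1%:R * (x - c)) - heaviside (n.+1%:R * (x - d)).
have ck n : continuous (k n).
  move=> x; apply: cvgB.
    apply: (@continuous_comp _ _ _ (fun x => n.+1%:R * (x - c))).
      by apply: cvgM; [exact: cvg_cst|apply: cvgB; [exact: cvg_id|exact: cvg_cst]].
    exact: continuous_heaviside.
  apply: (@continuous_comp _ _ _ (fun x => n.+1%:R * (x - d))).
    by apply: cvgM; [exact: cvg_cst|apply: cvgB; [exact: cvg_id|exact: cvg_cst]].
  exact: continuous_heaviside.
have kM n x : `|k n x| <= M + M by rewrite (le_trans (ler_normB _ _))// lerD.
have ifk n : mu.-integrable I (EFin \o (fun x => f x * k n x)).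
  by apply: (@integrable_mul_bounded _ _ _ _ _ _ (M + M)) => //; exact: continuous_measurable.
(* Only for large n does the second ramp finish before b, so that the trapezoid is compactly
   supported. *)
have eqk : \forall n \near \oo, \int[mu]_(x in I) (f x * k n x) =
    (d - c) * \int[mu]_(x in I) (f x * s x).
  near=> n; have n0 : 0 < n.+1%:R :> R by rewrite ltr0n.
  have dnb : d + n.+1%:R^-1 < b.
    rewrite -ltrBrDl invf_plt ?posrE ?subr_gt0//.
    by near: n; exact: near_ltr_nat.
  have := f0 _ (@smooth_trapezoid a b c d n.+1%:R) (compactly_supported_trapezoid ac cd n0 dnb).
  rewrite (derive1_is_derive (is_derive_trapezoid _ _ _ _ n0)) => /(congr1 fine)/= H.
  apply/eqP; rewrite -subr_eq0; apply/eqP; rewrite -[RHS]H.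
  rewrite -RintegralZl// -RintegralB//; last first.
    exact: (integrableZl _ _ ifs).
  by apply: eq_Rintegral => x _; rewrite /k /trapezoid' /s /l /r; ring.
pose g x : R := f x * ((c < x)%R%:R - (d < x)%R%:R).
have gE x : g x = (f \_ `]c, d]) x.
  rewrite /g patchE mem_setE in_itv/= [x <= d]leNgt.
  have [cx|xc] := ltP c x; have [dx|xd] := ltP d x; rewrite /= ?subrr ?mulr0 ?subr0 ?mulr1//.
  by have := lt_le_trans (lt_trans cd dx) xc; rewrite ltxx.
have cvk : [sequence (\int[mu]_(x in I) (EFin \o (fun x => (f x * k n x)%R)) x)%E]_n @ \oo -->
    (\int[mu]_(x in I) (g x)%:E)%E.
  have [] // := @dominated_convergence _ _ _ mu I mI
    (fun n => EFin \o (fun x => f x * k n x)) (EFin \o g) (fun x => (`|f x| * (M + M))%:E).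
  - by move=> n; exact: (measurable_int _ (ifk n)).
  - apply/measurable_EFinP; rewrite (_ : g = f \_ `]c, d]); last exact/funext.
    apply/(measurable_restrict _ _ mI) => //.
    apply: measurable_funS (mI) _ _; first exact: subIsetl.
    by apply/measurable_EFinP; exact: (measurable_int _ fi).
  - apply: aeW => x Ix; apply: cvg_EFin; first exact: nearW.
    apply: cvgM; first exact: cvg_cst.
    by apply: cvgB; exact: heaviside_cvg.
  - have ifn : mu.-integrable I (EFin \o (fun x => `|f x|)).
      exact: (integrable_abse fi).
    rewrite (_ : (fun x => _) = EFin \o (fun x => `|f x| * (M + M))); last exact/funext.
    apply: (@integrable_mul_bounded _ _ _ _ _ _ `|M + M|) => //.
  - by apply: aeW => x n Ix; rewrite lee_fin normrM ler_wpM2l.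
have Kg : \int[mu]_(x in I) g x = (d - c) * \int[mu]_(x in I) (f x * s x).
  rewrite /Rintegral -[RHS]/(fine ((d - c) * fine (\int[mu]_(x in I) (f x * s x)%:E))%:E).
  congr fine; apply: (cvg_unique _ cvk) => //.
  apply: cvg_near_cst; near=> n.
  rewrite -(near eqk n)//= fineK//.
  exact: (integrable_fin_num mI (ifk n)).
rewrite -Kg Rintegral_mkcond [RHS]Rintegral_mkcond; congr Rintegral.
apply/funext => x; rewrite patchE [RHS]patchE gE patchE.
rewrite !mem_setE !in_itv/=; case: ifPn => [/andP[cx xd]|_]; last by case: ifP.
by rewrite ifT// (lt_trans ac)//= (le_lt_trans xd).
Unshelve. all: by end_near. Qed.

(** By the interval version the primitive of [f] is affine with slope [K] near every point of ]a,
    b[, and by Lebesgue differentiation its derivative is [f] almost everywhere. *)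
Lemma du_bois_reymond a b f : a < b -> integrable_on_I a b f ->
  (forall phi, smooth phi -> compactly_supported a b phi ->
    (\int[mu]_(x in `]a, b[) (f x * derive1 phi x)%:E = 0)%E) ->
  exists K, {ae mu, forall x, `]a, b[%classic x -> f x = K}.
Proof.
move=> ab fi f0; have [K HK] := du_bois_reymond_itv ab fi f0; exists K.
set I := `]a, b[%classic.
have mI : measurable (I : set mR) by exact: measurable_itv.
pose g := f \_ I.
have gi : mu.-integrable setT (EFin \o g).
  by rewrite /g -restrict_EFin; apply/(integrable_mkcond _ mI).
have gS (D : set mR) : measurable D -> mu.-integrable D (EFin \o g).
  by move=> mD; apply: integrableS gi.
have := @FTC1Ny R g (fun y => gS _ (measurable_itv _)) (open_integrable_locally openT gi).
apply: filterS; first exact: (ae_filter_ringOfSetsType mu).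
move=> x [dF F'] Ix.
move: (Ix); rewrite /I/= in_itv/= => /andP[ax xb].
have gx : g x = f x by rewrite /g patchE mem_set.
rewrite -gx -F' derive1E.
pose F y := \int[mu]_(t in `]-oo, y]) g t.
pose x0 := (a + x) / 2.
have x0x : x0 < x by rewrite /x0; lra.
have ax0 : a < x0 by rewrite /x0; lra.
have Flin y : x0 < y -> y < b -> F y = F x0 + (y - x0) * K.
  move=> x0y yb; apply/eqP; rewrite addrC -subr_eq; apply/eqP.
  rewrite /F Rintegral_itvB ?bnd_simp ?(ltW x0y)//; last exact: gS.
  rewrite -(HK _ _ ax0 x0y yb); apply: eq_Rintegral => t; rewrite inE/= in_itv/= => /andP[x0t ty].
  by rewrite /g patchE mem_set// /I/= in_itv/= (lt_trans ax0)// (le_lt_trans ty).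
rewrite (@near_eq_derive _ _ _ _ (fun y => F x0 + K * (y - x0))).
  have dK : is_derive x (1 : R) (fun y => F x0 + K * (y - x0)) (0 + 1 * K).
    apply: is_deriveD.
    exact: (@is_derive_comp_affine id).
  by rewrite (@derive_val _ _ _ _ _ _ _ dK) add0r mul1r.
near=> y; rewrite [LHS]Flin 1?mulrC//; near: y; [exact: lt_nbhsr|exact: lt_nbhsl].
Unshelve. all: by end_near. Qed.

Lemma periodizeE a b f (k : int) x : a < b -> a <= x - (b - a) * k%:~R < b ->
  periodize a b f x = f (x - (b - a) * k%:~R).
Proof.
move=> ab /andP[ax xb]; have L0 : 0 < b - a by rewrite subr_gt0.
rewrite /periodize /period (@floor_def _ _ k)// intrD.
by rewrite ler_pdivlMr// ltr_pdivrMr//; apply/andP; split; lra.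
Qed.

Lemma period_floor a b x : a < b -> exists k : int, a <= x - (b - a) * k%:~R < b.
Proof.
move=> ab; have L0 : 0 < b - a by rewrite subr_gt0.
exists (Num.floor ((x - a) / (b - a))).
have := floor_itv ((x - a) / (b - a)).
rewrite intrD ler_pdivlMr// ltr_pdivrMr// => /andP[h1 h2]; apply/andP; split; lra.
Qed.

Lemma periodize_periodic a b f : a < b -> Defs.periodic a b (periodize a b f).
Proof.
move=> ab x; have [k kx] := period_floor x ab.
have e : x + period a b - (b - a) * (k + 1)%:~R = x - (b - a) * k%:~R.
  by rewrite /period intrD; ring.
by rewrite (periodizeE _ ab kx) (@periodizeE a b f (k + 1))// e.
Qed.

(** Near a point of the k-th period, the periodization is the sum of the translates of [phi] by k
    and k - 1 periods. The second one accounts for the left neighbours of a gluing point; by the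
    support condition at most one of the two terms is nonzero. *)
Lemma diffn_periodize a b y z n phi : a < y -> z < b -> a < b ->
  (forall x, ~~ (y <= x <= z) -> phi x = 0) -> diffn n phi ->
  diffn n (periodize a b phi).
Proof.
move=> ay zb ab; elim: n phi => // n IHn phi phi0 [phi' dphi dn].
have phi'0 x : ~~ (y <= x <= z) -> phi' x = 0.
  move=> xyz; rewrite -(@derive_val _ _ _ _ _ _ _ (dphi x)).
  rewrite (@near_eq_derive _ _ _ _ (fun=> (0 : R))) ?derive_cst//.
  move: xyz; rewrite negb_and -!ltNge => /orP[xy|zx].
    near=> w; rewrite phi0// negb_and -!ltNge; apply/orP; left.
    by near: w; exact: lt_nbhsl.
  near=> w; rewrite phi0// negb_and -!ltNge; apply/orP; right.
  by near: w; exact: lt_nbhsr.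
exists (periodize a b phi'); last exact: IHn.
move=> x; have [k kx] := period_floor x ab; have /andP[ax xb] := kx.
rewrite (periodizeE _ ab kx).
pose c := (b - a) * k%:~R; pose c' := (b - a) * (k - 1)%:~R.
have c'E : c' = c - (b - a) by rewrite /c' /c intrB; ring.
have xc' : phi' (x - c') = 0.
  apply: phi'0; rewrite negb_and -!ltNge; apply/orP; right.
  by rewrite c'E /c; lra.
have d e : is_derive x (1 : R) (fun w => phi (w - e)) (phi' (x - e)).
  have := @is_derive_comp_affine phi (phi' (x - e)) 1 e x.
  by rewrite mulr1 mul1r; under eq_fun do rewrite mul1r; apply.
have := is_deriveD (d c) (d c'); rewrite xc' addr0.
apply: near_eq_is_derive; near=> w; rewrite addrfctE.
have wb : w < b + c by near: w; apply: lt_nbhsl; rewrite /c; lra.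
have wa : a - (b - a) + c < w by near: w; apply: lt_nbhsr; rewrite /c; lra.
have [aw|wa'] := leP a (w - c).
  rewrite (@periodizeE a b phi k)//; last by rewrite aw/= -/c; lra.
  rewrite [X in _ + X]phi0 ?addr0// negb_and -!ltNge; apply/orP; right.
  by rewrite c'E; lra.
rewrite (@periodizeE a b phi (k - 1))//; last first.
  by rewrite -/c' c'E; apply/andP; split; lra.
rewrite [phi (w - c)]phi0 ?add0r// negb_and -!ltNge; apply/orP; left.
by lra.
Unshelve. all: by end_near. Qed.

Lemma smooth_periodize a b phi : a < b -> smooth phi ->
  compactly_supported a b phi -> smooth (periodize a b phi).
Proof.
move=> ab /smooth_diffn sphi [y [z [ay zb phi0]]]; apply/smooth_diffn => n.
exact: (diffn_periodize ay zb ab phi0).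
Qed.

End du_bois_reymond.

(** * Total variation and integrals of charges *)

Section charges_theory.
Context {R : realType}.
Local Notation mR := (measurableTypeR R).
Local Notation mu := (@lebesgue_measure R).
Implicit Types (nu rho tau : {charge set mR -> \bar R}) (A B X Y N : set mR).
Implicit Types (f : R -> R) (k q e : R).

(** Charges are finite, so values are handled as reals and inequalities between them fall to linear
    arithmetic. *)
Definition cval nu A : R := fine (nu A).

Lemma cvalE nu A : measurable A -> nu A = (cval nu A)%:E.
Proof. by move=> mA; rewrite fineK// fin_num_measure. Qed.

Lemma cval0 nu : cval nu set0 = 0.
Proof. by rewrite /cval charge0. Qed.

Lemma cvalU nu A B : measurable A -> measurable B -> A `&` B = set0 ->
  cval nu (A `|` B) = cval nu A + cval nu B.
Proof. by move=> mA mB AB; rewrite /cval chargeU// fineD// fin_num_measure. Qed.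

Lemma cval_split nu A X : measurable A -> measurable X ->
  cval nu A = cval nu (A `&` X) + cval nu (A `\` X).
Proof.
move=> mA mX; rewrite -cvalU ?setUIDK//; first exact: measurableI.
- exact: measurableD.
- by rewrite setDE setIACA setICr setI0.
Qed.

Lemma cval_cadd nu rho A : measurable A ->
  cval (cadd nu rho) A = cval nu A + cval rho A.
Proof. by move=> mA; rewrite /cval /cadd/= fineD// fin_num_measure. Qed.

Lemma cval_cscale k nu A : measurable A -> cval (cscale k nu) A = k * cval nu A.
Proof. by move=> mA; rewrite /cval /cscale/= fineM// fin_num_measure. Qed.

Lemma cval_copp nu A : cval (copp nu) A = - cval nu A.
Proof. by rewrite /cval /copp/= fineN. Qed.

Lemma cval_crestr0 nu X (mX : measurable X) A : measurable A ->
  cval (crestr0 nu mX) A = cval nu (A `&` X).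
Proof. by move=> mA; rewrite /cval /= /crestr0 mem_set. Qed.

Local Notation jpos nu := (jordan_pos (hahnP nu)).
Local Notation jneg nu := (jordan_neg (hahnP nu)).

Lemma measurable_hahn_pos nu : measurable (hahn_pos nu).
Proof. by have [[]] := hahnP nu. Qed.

Lemma measurable_hahn_neg nu : measurable (hahn_neg nu).
Proof. by have [_ []] := hahnP nu. Qed.

Lemma jposE nu A : measurable A -> jpos nu A = (cval nu (A `&` hahn_pos nu))%:E.
Proof.
move=> mA; rewrite jordan_posE cjordan_posE /crestr0 mem_set// /crestr.
by rewrite cvalE//; apply: measurableI => //; exact: measurable_hahn_pos.
Qed.

Lemma jnegE nu A : measurable A -> jneg nu A = (- cval nu (A `&` hahn_neg nu))%:E.
Proof.
move=> mA; rewrite jordan_negE cjordan_negE /crestr0 mem_set// /crestr.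
by rewrite cvalE//; apply: measurableI => //; exact: measurable_hahn_neg.
Qed.

Lemma cval_jordan nu A : measurable A ->
  cval nu A = fine (jpos nu A) - fine (jneg nu A).
Proof.
move=> mA; rewrite {1}/cval (jordan_decomp (hahnP nu) mA).
rewrite /cadd/= /cscale/= fineD ?fin_num_measure//; last by rewrite fin_numM// fin_num_measure.
by rewrite fineM ?fin_num_measure//= mulN1r.
Qed.

Definition tv nu X : R := fine (variation_on nu X).

Lemma variation_onE nu X : measurable X ->
  variation_on nu X = (tv nu X)%:E.
Proof.
move=> mX; rewrite /tv /variation_on /charge_variation/= fineK//.
by rewrite fin_numD !fin_num_measure.
Qed.

Lemma tv_jordan nu X : measurable X ->
  tv nu X = fine (jpos nu X) + fine (jneg nu X).
Proof.
by move=> mX; rewrite /tv /variation_on /charge_variation/= fineD// fin_num_measure.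
Qed.

(** Together with [tv_ge] this describes the total variation as the maximum of nu(A) - nu(B) over
    measurable subsets A, B of X. Variations of different charges can then be compared without
    relating their Hahn decompositions. *)
Lemma tv_attained nu X : measurable X ->
  exists A B, [/\ measurable A, measurable B, A `<=` X, B `<=` X
    & tv nu X = cval nu A - cval nu B].
Proof.
move=> mX; exists (X `&` hahn_pos nu), (X `&` hahn_neg nu); split.
- by apply: measurableI => //; exact: measurable_hahn_pos.
- by apply: measurableI => //; exact: measurable_hahn_neg.
- exact: subIsetl.
- exact: subIsetl.
- by rewrite tv_jordan// jposE// jnegE.
Qed.

Lemma fine_le_measure (m : {finite_measure set mR -> \bar R}) A B :
  measurable A -> measurable B -> A `<=` B -> fine (m A) <= fine (m B).
Proof.
move=> mA mB AB; apply: fine_le; rewrite ?fin_num_measure//.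
by apply: le_measure; rewrite ?inE.
Qed.

Lemma tv_ge nu X A B : measurable X -> measurable A -> measurable B ->
  A `<=` X -> B `<=` X -> cval nu A - cval nu B <= tv nu X.
Proof.
move=> mX mA mB AX BX; rewrite tv_jordan// !(cval_jordan nu)//.
have le (m : {finite_measure set mR -> \bar R}) (C : set mR) : measurable C -> C `<=` X ->
    0 <= fine (m C) <= fine (m X).
  by move=> mC CX; rewrite fine_ge0//= fine_le_measure.
have : 0 <= fine (jpos nu A) <= fine (jpos nu X) by exact: (le (jpos nu)).
have : 0 <= fine (jneg nu A) <= fine (jneg nu X) by exact: (le (jneg nu)).
have : 0 <= fine (jpos nu B) <= fine (jpos nu X) by exact: (le (jpos nu)).
have : 0 <= fine (jneg nu B) <= fine (jneg nu X) by exact: (le (jneg nu)).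
by clear le; lra.
Qed.

Lemma tv_ge_cval nu X A : measurable X -> measurable A -> A `<=` X ->
  `|cval nu A| <= tv nu X.
Proof.
move=> mX mA AX; rewrite ler_norml.
have := tv_ge nu mX mA measurable0 AX (@sub0set _ X).
have := tv_ge nu mX measurable0 mA (@sub0set _ X) AX.
by rewrite cval0; lra.
Qed.

Lemma tv_ge0 nu X : measurable X -> 0 <= tv nu X.
Proof. by move=> mX; rewrite (le_trans _ (tv_ge_cval nu mX mX _)). Qed.

Lemma eq_tv nu rho X : measurable X ->
  (forall A, measurable A -> A `<=` X -> cval nu A = cval rho A) ->
  tv nu X = tv rho X.
Proof.
move=> mX e; apply/eqP; rewrite eq_le; apply/andP; split.
  have [A [B [mA mB AX BX ->]]] := tv_attained nu mX.
  by rewrite !e//; exact: tv_ge.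
have [A [B [mA mB AX BX ->]]] := tv_attained rho mX.
by rewrite -!e//; exact: tv_ge.
Qed.

Lemma tv_cadd nu rho X : measurable X -> tv (cadd nu rho) X <= tv nu X + tv rho X.
Proof.
move=> mX; have [A [B [mA mB AX BX ->]]] := tv_attained (cadd nu rho) mX.
rewrite !cval_cadd//.
have := tv_ge nu mX mA mB AX BX; have := tv_ge rho mX mA mB AX BX; lra.
Qed.

Lemma tv_cscale k nu X : 0 <= k -> measurable X -> tv (cscale k nu) X <= k * tv nu X.
Proof.
move=> k0 mX; have [A [B [mA mB AX BX ->]]] := tv_attained (cscale k nu) mX.
by rewrite !cval_cscale// -mulrBr ler_wpM2l// tv_ge.
Qed.

Lemma tv_setU nu X Y : measurable X -> measurable Y -> X `&` Y = set0 ->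
  tv nu (X `|` Y) = tv nu X + tv nu Y.
Proof.
move=> mX mY XY; rewrite !tv_jordan//; last exact: measurableU.
rewrite !measureU// !fineD ?fin_num_measure//; lra.
Qed.

Lemma tv_proportional nu k X (m : {measure set mR -> \bar R}) :
  measurable X -> (m X < +oo)%E ->
  (forall A, measurable A -> A `<=` X -> cval nu A = k * fine (m A)) ->
  tv nu X = `|k| * fine (m X).
Proof.
move=> mX mXoo e.
have le C : measurable C -> C `<=` X -> 0 <= fine (m C) <= fine (m X).
  move=> mC CX; have h : (m C <= m X)%E by apply: le_measure; rewrite ?inE.
  by rewrite fine_ge0//= fine_le// ge0_fin_numE// (le_lt_trans h).
apply/eqP; rewrite eq_le; apply/andP; split.
  have [A [B [mA mB AX BX ->]]] := tv_attained nu mX; rewrite !e//.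
  rewrite -mulrBr (le_trans (ler_norm _))// normrM ler_wpM2l//.
  have /andP[a0 a1] := le _ mA AX; have /andP[b0 b1] := le _ mB BX.
  by rewrite ler_norml; lra.
have /andP[x0 _] := le _ mX (@subset_refl _ X).
by rewrite -{1}(ger0_norm x0) -normrM -e//; exact: tv_ge_cval.
Qed.

Definition ci nu X f : R := fine (charge_integral nu X f).

Definition bounded_on X f := exists M, forall x, X x -> `|f x| <= M.

Lemma integrable_bounded (m : {measure set mR -> \bar R}) X f :
  (m X < +oo)%E -> measurable X -> measurable_fun X f -> bounded_on X f ->
  m.-integrable X (EFin \o f).
Proof.
move=> mXoo mX mf [M fM]; apply: measurable_bounded_integrable => //.
exists M; split; first exact: num_real.
by move=> N MN x Dx /=; rewrite (le_trans (fM x Dx))// ltW.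
Qed.

Lemma finite_measure_lty (m : {finite_measure set mR -> \bar R}) X :
  measurable X -> (m X < +oo)%E.
Proof. by move=> mX; rewrite -ge0_fin_numE// fin_num_measure. Qed.

Lemma charge_integralE nu X f :
  measurable X -> measurable_fun X f -> bounded_on X f ->
  charge_integral nu X f = (ci nu X f)%:E.
Proof.
move=> mX mf bf; rewrite /ci fineK// /charge_integral fin_numB.
by rewrite !integrable_fin_num//; apply: integrable_bounded => //; exact: finite_measure_lty.
Qed.

Lemma ci_jordan nu X f :
  measurable X -> measurable_fun X f -> bounded_on X f ->
  ci nu X f = \int[jpos nu]_(x in X) f x - \int[jneg nu]_(x in X) f x.
Proof.
move=> mX mf bf; rewrite /ci /charge_integral fineB//.
all: apply: integrable_fin_num => //; apply: integrable_bounded => //.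
all: exact: finite_measure_lty.
Qed.

Lemma Rintegral_measure_add (m1 m2 : {measure set mR -> \bar R}) X f :
  (m1 X < +oo)%E -> (m2 X < +oo)%E ->
  measurable X -> measurable_fun X f -> bounded_on X f ->
  \int[measure_add m1 m2]_(x in X) f x =
  \int[m1]_(x in X) f x + \int[m2]_(x in X) f x.
Proof.
move=> m1X m2X mX mf bf; rewrite /Rintegral.
have i1 := integrable_bounded m1X mX mf bf.
have i2 := integrable_bounded m2X mX mf bf.
rewrite (integral_measure_add mX i1 i2).
exact: fineD (integrable_fin_num mX i1) (integrable_fin_num mX i2).
Qed.

Lemma measure_addEfin (m1 m2 : {measure set mR -> \bar R}) X A :
  (m1 X < +oo)%E -> (m2 X < +oo)%E -> measurable X -> measurable A -> A `<=` X ->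
  measure_add m1 m2 A = (fine (m1 A) + fine (m2 A))%:E.
Proof.
have fin (m : {measure set mR -> \bar R}) : (m X < +oo)%E -> measurable X -> measurable A ->
    A `<=` X -> m A \is a fin_num.
  move=> mXoo mX mA AX; rewrite ge0_fin_numE//.
  by rewrite (le_lt_trans _ mXoo)// le_measure// inE.
move=> m1X m2X mX mA AX; apply: (etrans (measure_addE _ _ _)).
by rewrite EFinD !fineK// fin.
Qed.

(** Any difference of measures may replace the Jordan decomposition: moving the negative terms
    across turns the hypothesis into an equality of two sums of measures on X, against which [f] is
    integrated. Linearity of [ci] in the charge follows. *)
Lemma ci_decomp nu (m1 m2 : {measure set mR -> \bar R}) X f :
  (m1 X < +oo)%E -> (m2 X < +oo)%E ->
  measurable X -> measurable_fun X f -> bounded_on X f ->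
  (forall A, measurable A -> A `<=` X -> cval nu A = fine (m1 A) - fine (m2 A)) ->
  ci nu X f = \int[m1]_(x in X) f x - \int[m2]_(x in X) f x.
Proof.
move=> m1X m2X mX mf bf e; rewrite ci_jordan//.
have pX : (jpos nu X < +oo)%E by exact: finite_measure_lty.
have nX : (jneg nu X < +oo)%E by exact: finite_measure_lty.
suff : \int[jpos nu]_(x in X) f x + \int[m2]_(x in X) f x =
       \int[jneg nu]_(x in X) f x + \int[m1]_(x in X) f x by lra.
rewrite -!Rintegral_measure_add// /Rintegral; congr fine.
apply: eq_measure_integral => A mA AX.
have := e A mA AX; rewrite cval_jordan// => h.
apply: (etrans (measure_addEfin pX m2X mX mA AX)); apply/esym.
apply: (etrans (measure_addEfin nX m1X mX mA AX)).
by congr EFin; move: h; clear; lra.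
Qed.

Lemma eq_ci nu rho X f :
  measurable X -> measurable_fun X f -> bounded_on X f ->
  (forall A, measurable A -> A `<=` X -> cval nu A = cval rho A) ->
  ci nu X f = ci rho X f.
Proof.
move=> mX mf bf e; rewrite [RHS]ci_jordan//; apply: ci_decomp => //.
- exact: finite_measure_lty.
- exact: finite_measure_lty.
- by move=> A mA AX; rewrite e// cval_jordan.
Qed.

Lemma ci_cadd nu rho X f :
  measurable X -> measurable_fun X f -> bounded_on X f ->
  ci (cadd nu rho) X f = ci nu X f + ci rho X f.
Proof.
move=> mX mf bf.
have pX tau : (jpos tau X < +oo)%E by exact: finite_measure_lty.
have nX tau : (jneg tau X < +oo)%E by exact: finite_measure_lty.
rewrite (@ci_decomp _ (measure_add (jpos nu) (jpos rho)) (measure_add (jneg nu) (jneg rho)))//.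
- rewrite (Rintegral_measure_add (pX nu) (pX rho) mX mf bf).
  rewrite (Rintegral_measure_add (nX nu) (nX rho) mX mf bf).
  by rewrite (ci_jordan nu mX mf bf) (ci_jordan rho mX mf bf); clear pX nX; lra.
- have h := measure_addEfin (pX nu) (pX rho) mX mX (@subset_refl _ X).
  by apply: (eq_ind_r (fun z => (z < +oo)%E) _ h); exact: ltry.
- have h := measure_addEfin (nX nu) (nX rho) mX mX (@subset_refl _ X).
  by apply: (eq_ind_r (fun z => (z < +oo)%E) _ h); exact: ltry.
move=> A mA AX; rewrite cval_cadd// !cval_jordan//.
have h1 := measure_addEfin (pX nu) (pX rho) mX mA AX.
have h2 := measure_addEfin (nX nu) (nX rho) mX mA AX.
apply: (etrans _ (esym (congr2 (fun y z => fine y - fine z) h1 h2))) => /=.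
clear h1 h2.
by clear pX nX; lra.
Qed.

Lemma Rintegral_mscale (m : {finite_measure set mR -> \bar R}) (k : {nonneg R}) X f :
  measurable X -> measurable_fun X f -> bounded_on X f ->
  \int[mscale k m]_(x in X) f x = k%:num * \int[m]_(x in X) f x.
Proof.
move=> mX mf bf; have i := integrable_bounded (finite_measure_lty m mX) mX mf bf.
have mf' := measurable_int _ i.
rewrite /Rintegral [in LHS]integralE [in RHS]integralE.
rewrite !ge0_integral_mscale//; last 2 first.
- exact: measurable_funeneg.
- exact: measurable_funepos.
rewrite -muleBr// ?fineM//.
- by rewrite fin_numB integrable_pos_fin_num// integrable_neg_fin_num.
- by apply: fin_num_adde_defr; rewrite integrable_pos_fin_num.
Qed.

Lemma ci_cscale k nu X f : 0 <= k ->
  measurable X -> measurable_fun X f -> bounded_on X f ->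
  ci (cscale k nu) X f = k * ci nu X f.
Proof.
move=> k0 mX mf bf; pose k' := NngNum k0.
rewrite (@ci_decomp _ (mscale k' (jpos nu)) (mscale k' (jneg nu)))//.
- by rewrite !Rintegral_mscale// ci_jordan// mulrBr.
- by rewrite /mscale/= lte_mul_pinfty// finite_measure_lty.
- by rewrite /mscale/= lte_mul_pinfty// finite_measure_lty.
move=> A mA AX; rewrite cval_cscale// !cval_jordan// /mscale/=.
by rewrite !fineM ?fin_num_measure//= mulrBr.
Qed.

Lemma Rintegral_concentrated (m : {finite_measure set mR -> \bar R}) X N f q e :
  measurable X -> measurable_fun X f -> bounded_on X f ->
  measurable N -> N `<=` X -> m (X `\` N) = 0 ->
  (forall x, N x -> `|f x - q| <= e) ->
  (q - e) * fine (m N) <= \int[m]_(x in X) f x <= (q + e) * fine (m N).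
Proof.
move=> mX mf bf mN NX mXN fq.
have mXoo := finite_measure_lty m mX.
have ifX := integrable_bounded mXoo mX mf bf.
have ifN : m.-integrable N (EFin \o f) by exact: integrableS ifX.
have mD : measurable (X `\` N) by exact: measurableD.
have mNoo : (m N < +oo)%E by rewrite -ge0_fin_numE// fin_num_measure.
have -> : \int[m]_(x in X) f x = \int[m]_(x in N) f x.
  have XE : X = N `|` (X `\` N) by rewrite setDUK.
  rewrite {1}XE Rintegral_setU//; last 2 first.
  - by rewrite -XE.
  - by apply/disj_setPS => x [? []].
  rewrite [X in _ + X]/Rintegral null_set_integral ?addr0//.
  by apply/measurable_EFinP; apply: measurable_funS mf => //; exact: subDsetl.
have icst c : m.-integrable N (EFin \o cst c) by exact: finite_measure_integrable_cst.
apply/andP; split; rewrite -(Rintegral_cst m mN).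
- apply: (le_Rintegral mN (icst (q - e)) ifN) => x Nx.
  by have := fq x Nx; rewrite ler_norml /cst; move: (f x) => y; lra.
- apply: (le_Rintegral mN ifN (icst (q + e))) => x Nx.
  by have := fq x Nx; rewrite ler_norml /cst; move: (f x) => y; lra.
Qed.

(** [f] is at least q - e against the positive part and at most q + e against the negative part, and
    nothing is charged outside N. This is how the flux gets frozen at the value q. *)
Lemma ci_concentrated nu X N f q e :
  measurable X -> measurable_fun X f -> bounded_on X f ->
  measurable N -> N `<=` X ->
  (forall A, measurable A -> A `<=` X -> cval nu A = cval nu (A `&` N)) ->
  (forall x, N x -> `|f x - q| <= e) ->
  q * cval nu N - e * tv nu N <= ci nu X f.
Proof.
move=> mX mf bf mN NX nuN fq; rewrite ci_jordan// cval_jordan// tv_jordan//.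
have mD : measurable (X `\` N) by exact: measurableD.
have mP := measurable_hahn_pos nu; have mQ := measurable_hahn_neg nu.
have null C : measurable C -> C `<=` X `\` N -> cval nu C = 0.
  move=> mC CXN; rewrite nuN//; last by move=> x /CXN[].
  rewrite (_ : C `&` N = set0) ?cval0//.
  by rewrite -subset0 => x [/CXN[]].
have pN : jpos nu (X `\` N) = 0.
  rewrite jposE// (_ : cval _ _ = 0)//; apply: null; last exact: subIsetl.
  exact: measurableI.
have nN : jneg nu (X `\` N) = 0.
  rewrite jnegE// (_ : cval _ _ = 0) ?oppr0//; apply: null; last exact: subIsetl.
  exact: measurableI.
have := Rintegral_concentrated mX mf bf mN NX pN fq.
have := Rintegral_concentrated mX mf bf mN NX nN fq.
by lra.
Qed.

End charges_theory.

(** * Distributional derivatives and cumulative functions *)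

Section cumulative.
Context {R : realType}.
Local Notation mR := (measurableTypeR R).
Local Notation mu := (@lebesgue_measure R).
Variables (a b : R).
Hypothesis ab : a < b.
Local Notation I := (`]a, b[%classic : set mR).
Variables (D : set mR).
Hypotheses (mD : measurable D) (Dab : D `<=` `[a, b[).
Implicit Types (m : {finite_measure set mR -> \bar R}) (phi : R -> R).

Lemma smooth_bounded phi : smooth phi ->
  exists2 C, 0 <= C & forall x, a <= x <= b -> `|phi x| <= C.
Proof.
move=> sphi.
have cns : {within `[a, b], continuous (fun x => `|phi x|)}.
  apply: continuous_subspaceT => x.
  by apply: continuous_comp; [exact: smooth_continuous|exact: norm_continuous].
have [e _ he] := EVT_max (ltW ab) cns.
by exists `|phi e| => // x xab; apply: he; rewrite in_itv/=.
Qed.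

(** The domain of integration is the section met in the Fubini argument below; s = a is included
    because the gluing point of the circle may carry an atom. *)
Lemma integral_derive1 phi s : smooth phi -> a <= s < b ->
  (\int[mu]_(x in I `&` `[s, +oo[) (derive1 phi x)%:E = (phi b - phi s)%:E)%E.
Proof.
move=> sphi /andP[sa0 sb].
have mder (A : set mR) : measurable A -> measurable_fun A (EFin \o derive1 phi).
  move=> mA; apply/measurable_EFinP; apply: continuous_measurable.
  exact: smooth_derive1_continuous.
have -> : (\int[mu]_(x in I `&` `[s, +oo[) (derive1 phi x)%:E =
           \int[mu]_(x in `[s, b]) (derive1 phi x)%:E)%E.
  rewrite -(integral_itv_bndo_bndc); last exact: mder.
  have [as_|] := ltP a s.
    congr integral; apply/seteqP; split => x /=; rewrite !in_itv/= andbT.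
      by move=> [/andP[_ ->] ->].
    by move=> /andP[sx ->]; rewrite sx (lt_le_trans as_ sx).
  move=> sa; have -> : s = a by apply/eqP; rewrite eq_le sa sa0.
  rewrite -(integral_itv_obnd_cbnd); last exact: mder.
  congr integral; apply/seteqP; split => x /=; rewrite !in_itv/= andbT.
    by move=> [].
  by move=> /andP[sx ->]; rewrite sx (ltW sx).
rewrite (@continuous_FTC2 _ _ phi)//.
- by apply: continuous_subspaceT; exact: smooth_derive1_continuous.
- split.
  + by move=> x _; exact: (sphi 0%N).
  + by apply: cvg_at_right_filter; exact: smooth_continuous.
  + by apply: cvg_at_left_filter; exact: smooth_continuous.
Qed.

(** Fubini for phi'(x) on the set s <= x: integrating in s first gives the left-hand side,
    integrating in x first gives phi(b) - phi(s). *)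
Lemma cumulative_by_parts m phi : smooth phi ->
  \int[mu]_(x in I) (derive1 phi x * fine (m (`]-oo, x] `&` D))) =
  phi b * fine (m D) - \int[m]_(s in D) phi s.
Proof.
move=> sphi.
have mI : measurable I by exact: measurable_itv.
have [C C0 HC] := smooth_bounded (smooth_derive1 sphi).
pose F (z : mR * mR) : R :=
  (\1_I z.1 * derive1 phi z.1) * (if z.2 <= z.1 then \1_D z.2 else 0).
have mF : measurable_fun setT F.
  apply: measurable_funM.
    have mh : measurable_fun setT (fun x : mR => \1_I x * derive1 phi x : R).
      apply: measurable_funM; first exact: measurable_indic.
      by apply: continuous_measurable; exact: smooth_derive1_continuous.
    exact: (measurableT_comp mh measurable_fst).
  apply: measurable_fun_ifT => //.
    apply: measurable_fun_ler; [exact: measurable_snd|exact: measurable_fst].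
  have mh : measurable_fun setT (fun y : mR => \1_D y : R) by exact: measurable_indic.
  exact: (measurableT_comp mh measurable_snd).
have FI : F = F \_ (I `*` setT).
  apply/funext => -[x s]; rewrite patchE; case: ifPn => // /negP xI.
  rewrite /F /= indicE memNset ?mul0r// => Ix; apply: xI.
  by rewrite inE.
have Fle z : `|F z| <= C.
  rewrite /F normrM indicE.
  have [|xI] := boolP (z.1 \in I); last by rewrite mul0r normr0 mul0r.
  rewrite inE/= in_itv/= => /andP[az zb].
  have h : `|derive1 phi z.1| <= C by apply: HC; rewrite (ltW az) ltW.
  rewrite mul1r.
  rewrite (le_trans _ h)// ler_piMr//.
  case: ifP => _; rewrite ?normr0// indicE.
  by case: (_ \in _); rewrite ?normr1 ?normr0.
have iF : (mu \x m)%E.-integrable setT (EFin \o F).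
  rewrite FI -restrict_EFin; apply/(integrable_mkcond _ (measurableX mI measurableT)).
  apply: measurable_bounded_integrable.
  - exact: measurableX.
  - have e := product_measure1E mu m mI (@measurableT _ mR).
    apply: (eq_ind_r (fun z => (z < +oo)%E) _ e); apply: lte_mul_pinfty => //.
      by rewrite /= lebesgue_measure_itv/=; case: ifP.
    exact: finite_measure_lty.
  - exact: measurable_funTS.
  - exists C; split; first exact: num_real.
    by move=> N CN z _ /=; rewrite (le_trans (Fle z))// ltW.
have := @Fubini _ _ _ _ R mu m (EFin \o F) iF.
have -> : (fun x => \int[m]_y (EFin \o F) (x, y))%E =
   ((fun x => (derive1 phi x * fine (m (`]-oo, x] `&` D)))%:E) \_ I)%E.
  apply/funext => x; rewrite patchE.
  have mx : measurable (`]-oo, x] `&` D) by apply: measurableI.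
  transitivity (\int[m]_(y in `]-oo, x] `&` D) (cst (\1_I x * derive1 phi x)%:E y))%E.
    rewrite [RHS]integral_mkcond; apply: eq_integral => y _; rewrite patchE /F/=.
    have -> : (y \in `]-oo, x] `&` D) = (y <= x) && (y \in D).
      by rewrite in_setI mem_setE in_itv.
    rewrite [\1_D _]indicE; case: (y <= x); case: (y \in D) => /=.
    - by rewrite mulr1.
    - by rewrite mulr0.
    - by rewrite mulr0.
    - by rewrite mulr0.
  rewrite integral_cst// indicE; case: ifPn => xI.
    by rewrite mul1r EFinM fineK// fin_num_measure.
  by rewrite mul0r mul0e.
rewrite -integral_mkcond => e1.
have e2 : (fun y => \int[mu]_x (EFin \o F) (x, y))%E =
   ((fun y => (phi b - phi y)%:E) \_ D)%E.
  apply/funext => s; rewrite patchE.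
  case: ifPn => [|sD]; last first.
    rewrite integral0_eq// => x _; rewrite /F/= [\1_D _]indicE (negbTE sD).
    by case: ifP; rewrite mulr0.
  rewrite inE => Ds; have := Dab Ds; rewrite /= in_itv/= => sab.
  rewrite -(integral_derive1 sphi sab) [RHS]integral_mkcond.
  apply: eq_integral => x _; rewrite patchE /F/=.
  have -> : (x \in I `&` `[s, +oo[) = (x \in I) && (s <= x).
    rewrite in_setI; congr andb.
    by apply/idP/idP => [|sx]; rewrite inE/= in_itv/= andbT.
  rewrite [\1_D _]indicE (mem_set Ds) [\1_I _]indicE.
  case: (x \in I); case: (s <= x) => /=.
  - by rewrite mul1r mulr1.
  - by rewrite mulr0.
  - by rewrite !mul0r.
  - by rewrite mulr0.
move: e1; rewrite e2 -integral_mkcond => /(congr1 fine) e1.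
have [Cphi _ HCphi] := smooth_bounded sphi.
have iphi : m.-integrable D (EFin \o phi).
  apply: integrable_bounded => //; first exact: finite_measure_lty.
    by apply: continuous_measurable; exact: smooth_continuous.
  exists Cphi => x /Dab; rewrite /= in_itv/= => /andP[ax xb]; apply: HCphi.
  by rewrite ax ltW.
rewrite [LHS]e1 -[fine _]/(\int[m]_(s in D) (phi b - phi s)) RintegralB ?Rintegral_cst//.
exact: finite_measure_integrable_cst.
Qed.

End cumulative.

(** * Combining almost everywhere statements *)

Section almost_everywhere.
Context {R : realType}.
Local Notation mu := (@lebesgue_measure R).
Implicit Types P Q : R -> Prop.

Lemma aeS P Q : (forall x, P x -> Q x) ->
  {ae mu, forall x, P x} -> {ae mu, forall x, Q x}.
Proof. by move=> PQ; apply: filterS => //; exact: (ae_filter_ringOfSetsType mu). Qed.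

Lemma aeI P Q : {ae mu, forall x, P x} -> {ae mu, forall x, Q x} ->
  {ae mu, forall x, P x /\ Q x}.
Proof. by apply: filterI; exact: (ae_filter_ringOfSetsType mu). Qed.

End almost_everywhere.

(** * Charges as derivatives of their cumulative functions *)

Section derivative_charges.
Context {R : realType}.
Local Notation mR := (measurableTypeR R).
Local Notation mu := (@lebesgue_measure R).
Variables (a b : R) (bc : boundary_condition R).
Hypothesis ab : a < b.
Local Notation I := (`]a, b[%classic : set mR).
Local Notation D := (domain a b bc).
Implicit Types (nu rho tau : {charge set mR -> \bar R}) (phi v : R -> R).
Implicit Types (A : set mR).

Definition is_periodic : bool := if bc is Periodic then true else false.

Lemma itv_sub_domain : I `<=` D.
Proof.
by rewrite /domain; case: bc => [A B||] x //=; rewrite !in_itv/= => /andP[/ltW -> ->].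
Qed.

Lemma domain_sub_itv : D `<=` `[a, b[.
Proof.
rewrite /domain; case: bc => [A B||] x //=; rewrite !in_itv/= => /andP[/ltW -> ->]//.
Qed.

Lemma mdomain : measurable (D : set mR). Proof. exact: measurable_domain. Qed.

Lemma measurableI_domain A : measurable A -> measurable (A `&` D).
Proof. by move=> mA; apply: measurableI => //; exact: mdomain. Qed.

Lemma test_function_bd phi : test_function a b bc phi ->
  [/\ smooth phi, phi b = phi a & ~~ is_periodic -> phi b = 0].
Proof.
move=> []; rewrite /is_periodic; case: bc => [A B||] /= sphi.
- move=> [y [z [ay zb h]]]; have := h a; have := h b.
  rewrite !negb_and -!ltNge ay zb orbT/= => -> // -> //.
- move=> [y [z [ay zb h]]]; have := h a; have := h b.
  rewrite !negb_and -!ltNge ay zb orbT/= => -> // -> //.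
- by move=> per; split => //; rewrite -(per a) /period addrC subrK.
Qed.

(** Periodizing lets compactly supported functions be tested on the circle too, so that one du
    Bois-Reymond lemma serves all boundary conditions. *)
Lemma test_function_extend phi : smooth phi -> compactly_supported a b phi ->
  exists2 psi, test_function a b bc psi &
    forall x, I x -> derive1 psi x = derive1 phi x.
Proof.
move=> sphi cphi; rewrite /test_function; case: bc => [A B||].
- by exists phi.
- by exists phi.
exists (periodize a b phi).
  by split; [exact: smooth_periodize|exact: periodize_periodic].
move=> x; rewrite /= in_itv/= => /andP[ax xb]; rewrite !derive1E.
apply: near_eq_derive; near=> w.
have wa : a < w by near: w; exact: lt_nbhsr.
have wb : w < b by near: w; exact: lt_nbhsl.
rewrite (@periodizeE _ a b phi 0)// mulr0 subr0//.
by rewrite (ltW wa).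
Unshelve. all: by end_near. Qed.

(** These are exactly the charges that are derivatives; on the circle a function returns to its
    value after one turn, hence the zero mass. *)
Definition admissible tau : Prop :=
  (forall A, measurable A -> cval tau A = cval tau (A `&` D)) /\
  (is_periodic -> cval tau D = 0).

Definition cum tau (x : R) : R := cval tau (`]-oo, x] `&` D).

Lemma smooth_bounded_on_domain phi : smooth phi -> bounded_on D phi.
Proof.
move=> sphi; have [C _ HC] := smooth_bounded ab sphi; exists C => x /domain_sub_itv.
by rewrite /= in_itv/= => /andP[ax xb]; apply: HC; rewrite ax ltW.
Qed.

Lemma smooth_bounded_on_itv phi : smooth phi -> bounded_on I phi.
Proof.
by move=> /smooth_bounded_on_domain[C HC]; exists C => x /itv_sub_domain; exact: HC.
Qed.

Lemma measurable_cum tau : measurable_fun (I : set mR) (cum tau).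
Proof.
have mI : measurable (I : set mR) by exact: measurable_itv.
have mono (m : {finite_measure set mR -> \bar R}) :
    measurable_fun I (fun x : R => fine (m (`]-oo, x] `&` D))).
  apply: nondecreasing_measurable => // x y xy.
  have mx z : measurable (`]-oo, z] `&` D) by exact: measurableI_domain.
  apply: fine_le_measure; [exact: mx|exact: mx|].
  by apply: setSI => t /=; rewrite !in_itv/= => /le_trans; apply.
have := measurable_funB (mono (jordan_pos (hahnP tau))) (mono (jordan_neg (hahnP tau))).
apply: eq_measurable_fun => x _; rewrite /cum cval_jordan//.
exact: measurableI_domain.
Qed.

Lemma cum_le tau x : `|cum tau x| <= tv tau setT.
Proof. by apply: tv_ge_cval => //; exact: measurableI_domain. Qed.

Lemma lebesgue_itv_fin : (mu I < +oo)%E.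
Proof. by rewrite /= lebesgue_measure_itv/=; case: ifP => // _; rewrite -EFinB ltry. Qed.

Lemma integrable_cum (c : R) tau : integrable_on_I a b (fun x => c + cum tau x).
Proof.
apply: integrable_bounded => //; first exact: lebesgue_itv_fin.
  apply: measurable_funD => //; exact: measurable_cum.
exists (`|c| + tv tau setT) => x _; rewrite (le_trans (ler_normD _ _))// lerD2l.
exact: cum_le.
Qed.

Lemma integrable_mul_derive1 v phi : integrable_on_I a b v -> smooth phi ->
  mu.-integrable I (EFin \o (fun x => v x * derive1 phi x)).
Proof.
move=> iv sphi; have [C HC] := smooth_bounded_on_itv (smooth_derive1 sphi).
apply: (integrable_mul_bounded _ iv _ HC) => //.
by apply: continuous_measurable; exact: smooth_derive1_continuous.
Qed.

Lemma cum_by_parts (c : R) tau phi : smooth phi ->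
  (\int[mu]_(x in I) ((c + cum tau x) * derive1 phi x)%:E =
   (c * (phi b - phi a) + (phi b * cval tau D - ci tau D phi))%:E)%E.
Proof.
move=> sphi; have mI : measurable (I : set mR) by exact: measurable_itv.
have i1 := integrable_mul_derive1 (integrable_cum c tau) sphi.
rewrite -[LHS]fineK; last exact: (integrable_fin_num mI i1).
congr EFin; rewrite -[LHS]/(\int[mu]_(x in I) ((c + cum tau x) * derive1 phi x)).
have bphi := smooth_bounded_on_domain sphi.
have mphi : measurable_fun D phi.
  by apply: continuous_measurable; exact: smooth_continuous.
have parts m := @cumulative_by_parts R a b ab D mdomain domain_sub_itv m phi sphi.
rewrite (ci_jordan tau mdomain mphi bphi) (cval_jordan tau mdomain).
have := parts (jordan_pos (hahnP tau)); have := parts (jordan_neg (hahnP tau)).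
have [C HC] := smooth_bounded_on_itv (smooth_derive1 sphi).
have ider : mu.-integrable I (EFin \o derive1 phi).
  apply: integrable_bounded => //; first exact: lebesgue_itv_fin.
  - by apply: continuous_measurable; exact: smooth_derive1_continuous.
  - by exists C.
have iM (m : {finite_measure set mR -> \bar R}) : mu.-integrable I
    (EFin \o (fun x => derive1 phi x * fine (m (`]-oo, x] `&` D)))).
  have mx z : measurable (`]-oo, z] `&` D) by exact: measurableI_domain.
  apply: (@integrable_mul_bounded _ _ _ mu I _ _ (fine (m setT)) mI ider).
    apply: nondecreasing_measurable => // x y xy.
    apply: fine_le_measure; [exact: mx|exact: mx|].
    by apply: setSI => t /=; rewrite !in_itv/= => /le_trans; apply.
  move=> x _; rewrite ger0_norm ?fine_ge0//; apply: fine_le_measure => //; exact: mx.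
have E0 : \int[mu]_(x in I) (c * derive1 phi x) = c * (phi b - phi a).
  rewrite RintegralZl//; congr (_ * _).
  have := @integral_derive1 R a b phi a sphi; rewrite lexx ab => /(_ isT)/(congr1 fine)/= <-.
  rewrite /Rintegral; congr fine; congr integral; apply/seteqP; split => x /=.
    by rewrite !in_itv/= andbT => /andP[ax ->]; rewrite ax (ltW ax).
  by case.
move=> e2 e1; rewrite -E0.
transitivity (\int[mu]_(x in I) (c * derive1 phi x +
   (derive1 phi x * fine (jordan_pos (hahnP tau) (`]-oo, x] `&` D)) -
    derive1 phi x * fine (jordan_neg (hahnP tau) (`]-oo, x] `&` D))))).
  apply: eq_Rintegral => x _; rewrite /cum cval_jordan; last exact: measurableI_domain.
  by rewrite mulrDl [(_ - _) * _]mulrC mulrBr.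
rewrite RintegralD//; last 2 first.
- exact: (integrableZl mI c ider).
- exact: (integrableB mI (iM (jordan_pos (hahnP tau))) (iM (jordan_neg (hahnP tau)))).
have := RintegralB mI (iM (jordan_pos (hahnP tau))) (iM (jordan_neg (hahnP tau))).
rewrite e1 e2 => ->; clear; ring.
Qed.

(** Integration by parts leaves the boundary term phi(b) tau(D), which vanishes because phi(b) = 0
    or, on the circle, because tau has mass zero. *)
Lemma is_derivative_charge_cum (c : R) tau : admissible tau ->
  is_derivative_charge a b bc (fun x => c + cum tau x) tau.
Proof.
move=> [tauD tau0]; split.
  by move=> A mA; rewrite (cvalE _ mA) (cvalE _ (measurableI_domain mA)) (tauD A mA).
move=> phi /test_function_bd[sphi phiba phib].
rewrite (cum_by_parts c tau sphi) charge_integralE; last 3 first.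
- exact: mdomain.
- by apply: continuous_measurable; exact: smooth_continuous.
- exact: smooth_bounded_on_domain.
rewrite -EFinN; congr EFin; rewrite phiba subrr mulr0 add0r.
have [per|nper] := boolP is_periodic; first by rewrite (tau0 per) mulr0 sub0r.
by rewrite -phiba (phib nper) mul0r sub0r.
Qed.

(** On the circle the constant 1 is a test function, and testing with it gives the mass. *)
Lemma admissible_derivative v nu : is_derivative_charge a b bc v nu -> admissible nu.
Proof.
move=> [nuD nuphi]; split; first by move=> A mA; rewrite /cval nuD.
move=> per; have t1 : test_function a b bc (fun=> 1).
  split; first by apply/smooth_diffn => n; exact: diffn_cst.
  by move: per; rewrite /is_periodic; case: bc => // _ x.
have := nuphi _ t1.
have -> : derive1 (fun=> 1 : R) = (fun=> 0).
  apply: derive1_is_derive => x; exact: is_derive_cst.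
rewrite integral0_eq; last by move=> x _; rewrite mulr0.
have m1 : measurable_fun D (fun=> 1 : R) by exact: measurable_cst.
have b1 : bounded_on D (fun=> 1 : R) by exists 1 => x _; rewrite normr1.
rewrite (charge_integralE _ mdomain m1 b1) -EFinN => /(congr1 fine)/= /eqP.
rewrite eq_sym oppr_eq0 (ci_jordan _ mdomain m1 b1) !Rintegral_cst ?mul1r; last 2 first.
- exact: mdomain.
- exact: mdomain.
by rewrite -(cval_jordan nu mdomain) => /eqP.
Qed.

(** [v] and the cumulative function of [nu] have the same distributional derivative, so the du
    Bois-Reymond lemma applies to their difference. *)
Lemma derivative_representation v nu :
  integrable_on_I a b v -> is_derivative_charge a b bc v nu ->
  exists C, {ae mu, forall x, I x -> v x = C + cum nu x}.
Proof.
move=> iv dv; have adm := admissible_derivative dv.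
have ic := integrable_cum 0 nu; have dc := is_derivative_charge_cum 0 adm.
have mI : measurable (I : set mR) by exact: measurable_itv.
have ivc : integrable_on_I a b (fun x => v x - (0 + cum nu x)).
  exact: (integrableB mI iv ic).
have [|K HK] := du_bois_reymond ab ivc.
  move=> phi sphi cphi; have [psi tpsi psiE] := test_function_extend sphi cphi.
  have [spsi _ _] := test_function_bd tpsi.
  have e1 := dv.2 _ tpsi; have e2 := dc.2 _ tpsi.
  have i1 := integrable_mul_derive1 iv spsi.
  have i2 := integrable_mul_derive1 ic spsi.
  transitivity (\int[mu]_(x in I) ((v x * derive1 psi x) - ((0 + cum nu x) * derive1 psi x))%:E)%E.
    apply: eq_integral => x; rewrite inE => Ix.
    by rewrite -(psiE _ Ix) mulrBl.
  rewrite (integralB_EFin mI i1 i2) e1 e2 subee//.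
  by rewrite -e1; exact: (integrable_fin_num mI i1).
exists K; move: HK; apply: aeS => x h Ix.
by rewrite -(h Ix) add0r subrK.
Qed.

End derivative_charges.

(** * Uniqueness of the derivative charge *)

Section interval_determination.
Context {R : realType}.
Local Notation mR := (measurableTypeR R).
Local Notation mu := (@lebesgue_measure R).
Implicit Types (nu rho : {charge set mR -> \bar R}) (A : set mR) (y z c d : R).

Lemma ae_dense y z (E : R -> Prop) :
  {ae mu, forall x, `]y, z[%classic x -> E x} ->
  forall c d, y <= c -> c < d -> d <= z -> exists2 x, c < x < d & E x.
Proof.
move=> [B [mB B0 EB]] c d yc cd dz; apply: contrapT => noE.
have cdB : `]c, d[%classic `<=` B.
  move=> x /=; rewrite in_itv/= => /andP[cx xd]; apply: EB => /= h.
  apply: noE; exists x; first by rewrite cx.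
  by apply: h; rewrite in_itv/= (le_lt_trans yc cx) (lt_le_trans xd dz).
have : (mu `]c, d[%classic <= 0)%E.
  by rewrite -B0; apply: le_measure => //; rewrite inE//; exact: measurable_itv.
by rewrite lebesgue_measure_itv/= lte_fin cd -EFinB lee_fin subr_le0 leNgt cd.
Qed.

Lemma itvoo_bigcup_itvcc c d : `]c, d[%classic =
  \bigcup_n `[c + n.+1%:R^-1, d - n.+1%:R^-1]%classic :> set R.
Proof.
apply/seteqP; split => x /=.
  rewrite in_itv/= => /andP[cx xd].
  have m0 : 0 < Num.min (x - c) (d - x) by rewrite lt_min !subr_gt0 cx.
  have [n _ /(_ n (leqnn n))] := near_ltr_nat (Num.min (x - c) (d - x))^-1.
  rewrite invf_plt ?posrE// => hn; exists n => //=.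
  move: hn; rewrite lt_min in_itv/=; move: (n.+1%:R^-1) => e /andP[h1 h2].
  by apply/andP; split; lra.
move=> [n _]/=; rewrite !in_itv/=.
have : 0 < n.+1%:R^-1 :> R by rewrite invr_gt0.
move: (n.+1%:R^-1) => e e0 /andP[h1 h2].
by apply/andP; split; lra.
Qed.

(** An open interval is an increasing union of closed ones, and between each of these and the open
    interval fits some ]e, f] with ends in the dense set [E], where the two measures agree. The
    inequality is used in both directions. *)
Lemma measure_itvoo_le (m1 m2 : {measure set mR -> \bar R}) y z (E : R -> Prop) :
  {ae mu, forall x, `]y, z[%classic x -> E x} ->
  (forall c d, y < c -> c < d -> d < z -> E c -> E d ->
    m1 `]c, d]%classic = m2 `]c, d]%classic) ->
  forall c d, y <= c -> d <= z -> (m1 `]c, d[%classic <= m2 `]c, d[%classic)%E.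
Proof.
move=> aeE m12 c d yc dz.
pose F (n : nat) := `[c + n.+1%:R^-1, d - n.+1%:R^-1]%classic : set mR.
have mF n : measurable (F n) by exact: measurable_itv.
have ndF : nondecreasing_seq F.
  move=> n k nk; apply/subsetPset => x; rewrite /F/= !in_itv/=.
  have : k.+1%:R^-1 <= n.+1%:R^-1 :> R by rewrite lef_pV2 ?posrE ?ler_nat.
  by move: (k.+1%:R^-1) (n.+1%:R^-1) => e1 e2 h /andP[h1 h2]; apply/andP; split; lra.
have mU : measurable (\bigcup_n F n) by exact: bigcupT_measurable.
have := nondecreasing_cvg_mu (mu := m1) mF mU ndF.
rewrite /F -itvoo_bigcup_itvcc => cv; rewrite -(cvg_lim _ cv)//.
apply: lime_le; first by apply/cvg_ex; eexists; exact: cv.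
apply: nearW => n /=.
have : 0 < n.+1%:R^-1 :> R by rewrite invr_gt0.
move: (n.+1%:R^-1) => k k0.
have [cd|dc] := leP (c + k) (d - k); last first.
  by rewrite set_itv_ge ?measure0// bnd_simp -ltNge.
have [|||e /andP[ce ec] Ee] := ae_dense aeE (c := c) (d := c + k); [lra|lra|lra|].
have [|||f /andP[df fd] Ef] := ae_dense aeE (c := d - k) (d := d); [lra|lra|lra|].
apply: (@le_trans _ _ (m1 `]e, f]%classic)).
  apply: le_measure; rewrite ?inE//; try exact: measurable_itv.
  by move=> x /=; rewrite !in_itv/= => /andP[h1 h2]; apply/andP; split; lra.
have -> : m1 `]e, f]%classic = m2 `]e, f]%classic.
  by apply: m12 => //; [lra|lra|lra].
apply: le_measure; rewrite ?inE//; try exact: measurable_itv.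
by move=> x /=; rewrite !in_itv/= => /andP[h1 h2]; apply/andP; split; lra.
Qed.

Lemma itvooI (x1 y1 x2 y2 : R) : `]x1, y1[ `&` `]x2, y2[ =
  `](Num.max x1 x2), (Num.min y1 y2)[%classic :> set R.
Proof.
apply/seteqP; split => x /=; rewrite !in_itv/= gt_max lt_min.
  by move=> [/andP[-> ->] /andP[-> ->]].
by move=> /andP[/andP[-> ->] /andP[-> ->]].
Qed.

(** The restrictions of the measures to ]y, z[ agree on open intervals, a family stable under
    intersection that generates the Borel sets. *)
Lemma measure_eq_on_itv (m1 m2 : {measure set mR -> \bar R}) y z (E : R -> Prop) :
  (m1 setT < +oo)%E ->
  {ae mu, forall x, `]y, z[%classic x -> E x} ->
  (forall c d, y < c -> c < d -> d < z -> E c -> E d ->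
    m1 `]c, d]%classic = m2 `]c, d]%classic) ->
  forall A, measurable A -> A `<=` `]y, z[ -> m1 A = m2 A.
Proof.
move=> m1oo aeE m12 A mA AJ.
have mJ : measurable (`]y, z[%classic : set mR) by exact: measurable_itv.
suff : mrestr m1 mJ A = mrestr m2 mJ A by rewrite /mrestr !setIidl.
apply: (@measure_unique _ R mR (@RGenOpens.G R) (fun n => `](- n%:R), n%:R[%classic)) => //.
- exact: RGenOpens.measurableE.
- move=> _ _ [x1 [y1 ->]] [x2 [y2 ->]].
  by exists (Num.max x1 x2), (Num.min y1 y2); exact: itvooI.
- by move=> n; exists (- n%:R), n%:R.
- apply/seteqP; split => // x _.
  have [n _ /(_ n (leqnn n)) hn] := near_ltr_nat `|x|.
  by exists n.+1 => //=; rewrite in_itv/= -ltr_norml.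
- move=> _ [c [d ->]]; rewrite /= /mrestr itvooI.
  have hy : y <= Num.max c y by rewrite le_max lexx orbT.
  have hz : Num.min d z <= z by rewrite ge_min lexx orbT.
  apply/eqP; rewrite eq_le; apply/andP; split.
    exact: (measure_itvoo_le aeE m12 hy hz).
  apply: (measure_itvoo_le aeE _ hy hz) => ? ? ? ? ? ? ?; exact/esym/m12.
- move=> n; apply: (le_lt_trans _ m1oo); rewrite /= /mrestr.
  apply: le_measure; rewrite ?inE//.
  by apply: measurableI => //; exact: measurable_itv.
Qed.

(** Reduced to measures by comparing the sums nu^+ + rho^- and rho^+ + nu^-. *)
Lemma cval_eq_on_itv nu rho y z (E : R -> Prop) :
  {ae mu, forall x, `]y, z[%classic x -> E x} ->
  (forall c d, y < c -> c < d -> d < z -> E c -> E d ->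
    cval nu `]c, d]%classic = cval rho `]c, d]%classic) ->
  forall A, measurable A -> A `<=` `]y, z[ -> cval nu A = cval rho A.
Proof.
move=> aeE nurho A mA AJ.
pose m1 : {measure set mR -> \bar R} := measure_add (jordan_pos (hahnP nu)) (jordan_neg (hahnP rho)).
pose m2 : {measure set mR -> \bar R} := measure_add (jordan_pos (hahnP rho)) (jordan_neg (hahnP nu)).
have m1E (B : set mR) : measurable B -> m1 B =
    (fine (jordan_pos (hahnP nu) B) + fine (jordan_neg (hahnP rho) B))%:E.
  by move=> mB; apply: (measure_addEfin (X := setT)) => //; exact: finite_measure_lty.
have m2E (B : set mR) : measurable B -> m2 B =
    (fine (jordan_pos (hahnP rho) B) + fine (jordan_neg (hahnP nu) B))%:E.
  by move=> mB; apply: (measure_addEfin (X := setT)) => //; exact: finite_measure_lty.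
have eqm (B : set mR) : measurable B -> m1 B = m2 B <-> cval nu B = cval rho B.
  move=> mB; rewrite m1E// m2E// !cval_jordan//; clear m1E m2E.
  by split=> [[]|] h; [|congr EFin]; lra.
apply/eqm => //.
apply: (measure_eq_on_itv _ aeE) => //.
  by rewrite m1E ?ltry.
move=> c d yc cd dz Ec Ed; apply/eqm; first exact: measurable_itv.
exact: nurho.
Qed.

End interval_determination.

(** * The charge determined by the function, and the energy expressed on charges *)

Section derivative_charge_uniqueness.
Context {R : realType}.
Local Notation mR := (measurableTypeR R).
Local Notation mu := (@lebesgue_measure R).
Variables (a b : R) (bc : boundary_condition R).
Hypothesis ab : a < b.
Local Notation I := (`]a, b[%classic : set mR).
Local Notation D := (domain a b bc).
Local Notation lam := (lebesgue_charge a b bc).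
Implicit Types (nu rho tau : {charge set mR -> \bar R}) (v : R -> R).
Implicit Types (A : set mR).

Lemma cum_itv nu c d : a <= c -> c <= d -> d < b ->
  cum a b bc nu d - cum a b bc nu c = cval nu `]c, d]%classic.
Proof.
move=> ac cd db.
have e : `]-oo, d] `&` D = (`]-oo, c] `&` D) `|` `]c, d]%classic.
  apply/seteqP; split => x /=; rewrite !in_itv/=.
    move=> [xd Dx]; have [xc|cx] := leP x c; [by left|by right].
  move=> [[xc Dx]|/andP[cx xd]]; first by rewrite (le_trans xc cd).
  split=> //; apply: itv_sub_domain => /=.
  by rewrite in_itv/= (le_lt_trans ac cx) (le_lt_trans xd db).
rewrite /cum e cvalU; last 3 first.
- exact: measurableI_domain.
- exact: measurable_itv.
- by rewrite -subset0 => x /=; rewrite !in_itv/= => -[[xc _] /andP[cx _]]; move: xc; rewrite leNgt cx.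
- by rewrite addrAC subrr add0r.
Qed.

Lemma cval_eq_of_cum nu rho y z (C : R) : a <= y -> z <= b ->
  {ae mu, forall x, `]y, z[%classic x -> cum a b bc nu x = C + cum a b bc rho x} ->
  forall A, measurable A -> A `<=` `]y, z[ -> cval nu A = cval rho A.
Proof.
move=> ay zb h; apply: (cval_eq_on_itv h) => c d yc cd dz /= ec ed.
have ac : a <= c by rewrite (le_trans ay)// ltW.
have db : d < b by rewrite (lt_le_trans dz).
rewrite -(cum_itv _ ac (ltW cd) db) -(cum_itv _ ac (ltW cd) db) ec ed; lra.
Qed.

(** Inside ]a, b[ the charges are read off from their cumulative functions, which differ by a
    constant. On the circle there remains the atom at the gluing point, fixed by the requirement of
    mass zero. *)
Lemma derivative_charge_unique v nu rho : integrable_on_I a b v ->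
  is_derivative_charge a b bc v nu -> is_derivative_charge a b bc v rho ->
  forall A, measurable A -> cval nu A = cval rho A.
Proof.
move=> iv dnu drho.
have [nuD nu0] := admissible_derivative dnu; have [rhoD rho0] := admissible_derivative drho.
have [C1 h1] := derivative_representation ab iv dnu.
have [C2 h2] := derivative_representation ab iv drho.
have mI : measurable I by exact: measurable_itv.
have eqI A : measurable A -> A `<=` I -> cval nu A = cval rho A.
  apply: (@cval_eq_of_cum nu rho a b (C2 - C1)) => //.
  by move: (aeI h1 h2); apply: aeS => x [e1 e2] Ix; have := e1 Ix; have := e2 Ix; lra.
have eqD A : measurable A -> A `<=` D -> cval nu A = cval rho A.
  move=> mA AD; rewrite (cval_split nu mA mI) (cval_split rho mA mI).
  congr (_ + _); first by apply: eqI; [exact: measurableI|exact: subIsetr].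
  have [per|nper] := boolP (is_periodic bc); last first.
    suff -> : A `\` I = set0 by rewrite !cval0.
    rewrite -subset0 => x [/AD Dx]; apply.
    by move: nper Dx; rewrite /is_periodic /domain; case: bc.
  have aE : D `\` I = [set a].
    move: per; rewrite /is_periodic /domain; case: bc => // _.
    apply/seteqP; split => x /=; rewrite !in_itv/=.
      move=> [/andP[ax xb] /negP]; rewrite xb andbT -leNgt => xa.
      by apply/eqP; rewrite eq_le xa.
    by move=> ->; rewrite lexx ab ltxx.
  have AIa : A `\` I `<=` [set a] by rewrite -aE; exact: setSD.
  have [->|A0] := eqVneq (A `\` I) set0; first by rewrite !cval0.
  have -> : A `\` I = [set a].
    apply/seteqP; split => // _ ->; have /set0P[x Ax] := A0.
    by have xa : x = a := AIa x Ax; rewrite xa in Ax.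
  have h nu' : cval nu' [set a] = cval nu' D - cval nu' I.
    have ID : D `&` I = I by apply: setIidr; exact: itv_sub_domain.
    by rewrite (cval_split nu' (mdomain a b bc) mI) ID aE addrAC subrr add0r.
  by rewrite !h nu0// rho0// (eqI I).
by move=> A mA; rewrite nuD// rhoD//; apply: eqD; [exact: measurableI_domain|exact: subIsetr].
Qed.

Lemma cval_lam A : measurable A -> cval lam A = fine (mu (A `&` D)).
Proof. by []. Qed.

Lemma cval_lam_sub A : measurable A -> A `<=` D -> cval lam A = fine (mu A).
Proof. by move=> mA AD; rewrite cval_lam// setIidl. Qed.

Lemma cum_lam c d : a <= c -> c <= d -> d < b -> cum a b bc lam d - cum a b bc lam c = d - c.
Proof.
move=> ac cd db; rewrite cum_itv// cval_lam_sub.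
- rewrite lebesgue_measure_itv/= lte_fin; case: ltP => // dc.
  by rewrite /=; apply/esym/eqP; rewrite subr_eq0 eq_le cd dc.
- exact: measurable_itv.
move=> x /=; rewrite in_itv/= => /andP[cx xd]; apply: itv_sub_domain => /=.
by rewrite in_itv/= (le_lt_trans ac cx) (le_lt_trans xd db).
Qed.

Lemma cum_cadd nu rho x : cum a b bc (cadd nu rho) x = cum a b bc nu x + cum a b bc rho x.
Proof. by rewrite /cum cval_cadd//; exact: measurableI_domain. Qed.

Lemma cum_cscale k nu x : cum a b bc (cscale k nu) x = k * cum a b bc nu x.
Proof. by rewrite /cum cval_cscale//; exact: measurableI_domain. Qed.

Lemma cum_lamE x : a < x -> x < b -> cum a b bc lam x = cum a b bc lam a + (x - a).
Proof. by move=> ax xb; rewrite -(@cum_lam a x)// ?ltW//; lra. Qed.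

Lemma derivative_chargeP v : (exists nu, is_derivative_charge a b bc v nu) ->
  is_derivative_charge a b bc v (derivative_charge a b bc v).
Proof.
by move=> ex; rewrite /derivative_charge; case: pselect => // ex'; case: cid.
Qed.

Lemma is_derivative_charge_ae v w nu :
  measurable_fun I v -> measurable_fun I w ->
  {ae mu, forall x, I x -> v x = w x} ->
  is_derivative_charge a b bc v nu -> is_derivative_charge a b bc w nu.
Proof.
move=> mv mw vw [nuD nuphi]; split => // phi tphi; rewrite -nuphi//.
have [sphi _ _] := test_function_bd tphi.
have mder : measurable_fun I (derive1 phi).
  by apply: continuous_measurable; exact: smooth_derive1_continuous.
apply: ae_eq_integral.
- exact: measurable_itv.
- by apply/measurable_EFinP; exact: measurable_funM.
- by apply/measurable_EFinP; exact: measurable_funM.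
- by move: vw; apply: aeS => x e Ix; rewrite e.
Qed.

(* On the circle [c x] is no function, so the shift is made on the charge. *)
Lemma cval_derivative_charge_shift (c : R) v nu : integrable_on_I a b v ->
  is_derivative_charge a b bc v nu ->
  forall A, measurable A ->
  cval (derivative_charge_shift a b bc c v) A = cval (cadd nu (cscale c lam)) A.
Proof.
move=> iv dv A mA.
have nuE := derivative_charge_unique iv dv (derivative_chargeP (ex_intro _ _ dv)).
have [nuD nu0] := admissible_derivative dv.
have [per|nper] := boolP (is_periodic bc).
  have -> : derivative_charge_shift a b bc c v =
      cadd (derivative_charge a b bc v) (cscale c lam).
    by move: per; rewrite /is_periodic /derivative_charge_shift; case: bc.
  by rewrite !cval_cadd// -nuE.
have -> : derivative_charge_shift a b bc c v = derivative_charge a b bc (fun x => v x + c * x).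
  by move: nper; rewrite /is_periodic /derivative_charge_shift; case: bc.
have adm : admissible a b bc (cadd nu (cscale c lam)).
  split; last by move/negP: nper.
  move=> B mB; have mBD := measurableI_domain a b bc mB.
  rewrite !cval_cadd// !cval_cscale// -nuD// [in RHS]cval_lam//.
  by rewrite -setIA setIid.
have [C hC] := derivative_representation ab iv dv.
have mv : measurable_fun I v by apply/measurable_EFinP; exact: (measurable_int _ iv).
have mid : measurable_fun I (fun x : R => c * x) by exact: measurable_funM.
have mvc : measurable_fun I (fun x => v x + c * x) by exact: measurable_funD.
have ivc : integrable_on_I a b (fun x => v x + c * x).
  have mI : measurable I by exact: measurable_itv.
  suff icx : integrable_on_I a b (fun x => c * x) by exact: (integrableD mI iv icx).
  apply: integrable_bounded => //; first exact: lebesgue_itv_fin.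
  exists (`|c| * (`|a| + `|b|)) => x; rewrite /= in_itv/= => /andP[ax xb].
  rewrite normrM ler_wpM2l// ler_norml.
  have := ler_norm b; have := ler_norm (- a); rewrite normrN.
  have := normr_ge0 a; have := normr_ge0 b; lra.
(* The constant absorbs the difference between c x and c times the cumulative function of [lam]. *)
pose C' := C - c * cum a b bc lam a + c * a.
have d' : is_derivative_charge a b bc (fun x => v x + c * x) (cadd nu (cscale c lam)).
  apply: (@is_derivative_charge_ae (fun x => C' + cum a b bc (cadd nu (cscale c lam)) x)) => //.
  - apply: measurable_funD => //; exact: measurable_cum.
  - move: hC; apply: aeS => x h Ix; rewrite h// cum_cadd cum_cscale.
    move: Ix; rewrite /= in_itv/= => /andP[ax xb]; rewrite cum_lamE// /C'; ring.
  - exact: is_derivative_charge_cum.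
by apply/esym/(derivative_charge_unique ivc d' (derivative_chargeP (ex_intro _ _ d'))).
Qed.

(** [W_energy] in terms of the derivative charge. It also makes sense for charges of nonzero mass on
    the circle, as the multiplier argument requires. *)
Definition energy tau : R :=
  tv (cadd tau (cscale 1 lam)) D + tv (cadd tau (cscale (-1) lam)) D.

Lemma W_energyE v nu : integrable_on_I a b v -> is_derivative_charge a b bc v nu ->
  W_energy a b bc v = (energy nu)%:E.
Proof.
move=> iv dv; have mD := mdomain a b bc.
rewrite /W_energy !variation_onE// -EFinD /energy; congr (_ + _)%:E.
  by apply: eq_tv => // A mA _; exact: cval_derivative_charge_shift.
by apply: eq_tv => // A mA _; exact: cval_derivative_charge_shift.
Qed.

End derivative_charge_uniqueness.

(** * The selection inequality *)

Section selection.
Context {R : realType}.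
Local Notation mR := (measurableTypeR R).
Local Notation mu := (@lebesgue_measure R).
Variables (a b : R) (bc : boundary_condition R).
Hypothesis ab : a < b.
Local Notation I := (`]a, b[%classic : set mR).
Local Notation D := (domain a b bc).
Local Notation lam := (lebesgue_charge a b bc).
Local Notation energy := (energy a b bc).
Implicit Types (nu rho tau : {charge set mR -> \bar R}) (f g v w : R -> R).
Implicit Types (A N : set mR).

Lemma continuous_representative_within f g : continuous_representative a b bc f g ->
  {within `[a, b], continuous g}.
Proof.
by rewrite /continuous_representative; case: bc => [A B||] [_]// [cg _];
  exact: continuous_subspaceT.
Qed.

Lemma continuous_representative_domain f g : continuous_representative a b bc f g ->
  measurable_fun D g /\ bounded_on D g.
Proof.
move=> /continuous_representative_within cg.
have Dab : D `<=` `[a, b]%classic.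
  by move=> x /domain_sub_itv; rewrite /= !in_itv/= => /andP[-> /ltW].
split.
  apply: (measurable_funS (measurable_itv `[a, b]) Dab).
  exact: (subspace_continuous_measurable_fun (measurable_itv `[a, b]) cg).
have cng : {within `[a, b], continuous (fun x => `|g x|)}.
  by move=> x; apply: continuous_comp; [exact: cg|exact: norm_continuous].
have [e _ he] := EVT_max (ltW ab) cng.
by exists `|g e| => x /Dab; exact: he.
Qed.

(** [admissible] without the mass condition: restricting a charge to a subset preserves this class,
    but on the circle not the other one. *)
Definition supported tau := forall A, measurable A -> cval tau A = cval tau (A `&` D).

Lemma supported_cadd nu rho : supported nu -> supported rho -> supported (cadd nu rho).
Proof.
move=> snu srho A mA; have mAD := measurableI_domain a b bc mA.
by rewrite !cval_cadd// snu// srho.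
Qed.

Lemma supported_cscale k nu : supported nu -> supported (cscale k nu).
Proof.
move=> snu A mA; have mAD := measurableI_domain a b bc mA.
by rewrite !cval_cscale// snu.
Qed.

Lemma supported_lam : supported lam.
Proof.
move=> A mA; have mAD := measurableI_domain a b bc mA.
by rewrite !cval_lam// -setIA setIid.
Qed.

Lemma energy_convex nu rho1 rho2 (t1 t2 : R) : 0 <= t1 -> 0 <= t2 -> t1 + t2 = 1 ->
  energy (cadd nu (cadd (cscale t1 rho1) (cscale t2 rho2))) <=
  t1 * energy (cadd nu rho1) + t2 * energy (cadd nu rho2).
Proof.
move=> t10 t20 t12; have mD := mdomain a b bc.
have h k : tv (cadd (cadd nu (cadd (cscale t1 rho1) (cscale t2 rho2))) (cscale k lam)) D <=
    t1 * tv (cadd (cadd nu rho1) (cscale k lam)) D +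
    t2 * tv (cadd (cadd nu rho2) (cscale k lam)) D.
  rewrite (@eq_tv _ _ (cadd (cscale t1 (cadd (cadd nu rho1) (cscale k lam)))
      (cscale t2 (cadd (cadd nu rho2) (cscale k lam)))))//.
    by rewrite (le_trans (tv_cadd _ _ mD))// lerD// tv_cscale.
  move=> A mA _; rewrite !(cval_cadd, cval_cscale)//.
  have -> : t2 = 1 - t1 by rewrite -t12 addrAC subrr add0r.
  by ring.
rewrite !mulrDr addrACA; exact: (lerD (h 1) (h (-1))).
Qed.

(** The competitor is the cumulative function of Dw + rho; by uniqueness of derivative charges its
    difference to Dw is rho, which turns the inequality for functions into one for charges. *)
Lemma selection_admissible w f : BV a b bc w -> subdifferential_selection a b bc w f ->
  exists2 g, continuous_representative a b bc f g &
    forall rho, admissible a b bc rho ->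
      energy (derivative_charge a b bc w) + ci rho D g <=
      energy (cadd (derivative_charge a b bc w) rho).
Proof.
move=> [iw exw] [g [cg sel]]; exists g => // rho [rhoD rho0].
have mD := mdomain a b bc.
have dw := derivative_chargeP exw; set nu := derivative_charge a b bc w in dw *.
have [nuD nu0] := admissible_derivative dw.
have adm : admissible a b bc (cadd nu rho).
  split; first exact: supported_cadd.
  by move=> per; rewrite cval_cadd// nu0// rho0// addr0.
pose v x := 0 + cum a b bc (cadd nu rho) x.
have iv : integrable_on_I a b v by exact: integrable_cum.
have dv : is_derivative_charge a b bc v (cadd nu rho) by exact: is_derivative_charge_cum.
have bvv : BV a b bc v by split => //; exists (cadd nu rho).
have [mg bg] := continuous_representative_domain cg.
have := sel _ bvv; rewrite -/nu.
rewrite (W_energyE ab iw dw) (W_energyE ab iv dv) charge_integralE// -EFinD lee_fin.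
rewrite (@eq_ci _ _ rho)// => A mA _.
have := derivative_charge_unique ab iv dv (derivative_chargeP (ex_intro _ _ dv)).
by move=> /(_ A mA); rewrite !cval_cadd// cval_copp => <-; rewrite addrAC subrr add0r.
Qed.

(* On the circle the flux is only determined up to an additive constant, since
   derivatives have mass zero there; [c] is a Lagrange multiplier for that
   constraint, obtained as a slope separating the negative from the positive
   masses. *)
Lemma selection_multiplier w f : BV a b bc w -> subdifferential_selection a b bc w f ->
  exists g c, continuous_representative a b bc f g /\
    forall rho, supported rho ->
      energy (derivative_charge a b bc w) + ci rho D g + c * cval rho D <=
      energy (cadd (derivative_charge a b bc w) rho).
Proof.
move=> bvw sel; have [g cg hg] := selection_admissible bvw sel; exists g.
set nu := derivative_charge a b bc w in hg *.
have [per|nper] := boolP (is_periodic bc); last first.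
  exists 0; split => // rho srho; rewrite mul0r addr0; apply: hg; split => //.
  by move/negP: nper.
have mD := mdomain a b bc; have [mg bg] := continuous_representative_domain cg.
(* [Phi] is convex and nonnegative on charges of mass zero; the goal is to bound it below by a
   multiple of the mass. *)
pose Phi rho := energy (cadd nu rho) - energy nu - ci rho D g.
have Phi0 rho : supported rho -> cval rho D = 0 -> 0 <= Phi rho.
  move=> srho rho0; have := hg rho (conj srho (fun _ => rho0)).
  rewrite /Phi; move: (energy (cadd nu rho)) (energy nu) (ci rho D g) => x y z.
  by clear; lra.
have slope rho1 rho2 : supported rho1 -> supported rho2 ->
    cval rho1 D < 0 -> 0 < cval rho2 D ->
    Phi rho1 / cval rho1 D <= Phi rho2 / cval rho2 D.
  move=> s1 s2; move r1 : (cval rho1 D) => m1; move r2 : (cval rho2 D) => m2 m1lt m2gt.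
  have m0 : 0 < m2 - m1 by lra.
  (* The convex weights for which the combination of [rho1] and [rho2] has mass zero. *)
  pose t1 := m2 / (m2 - m1); pose t2 := - m1 / (m2 - m1).
  have t10 : 0 <= t1 by rewrite divr_ge0// ltW.
  have t20 : 0 <= t2 by rewrite divr_ge0 ?ltW// oppr_gt0.
  have t12 : t1 + t2 = 1 by rewrite /t1 /t2 -mulrDl divff// gt_eqF.
  have s12 := supported_cadd (supported_cscale t1 s1) (supported_cscale t2 s2).
  have mass0 : cval (cadd (cscale t1 rho1) (cscale t2 rho2)) D = 0.
    by rewrite cval_cadd// !cval_cscale// r1 r2 /t1 /t2; field; rewrite gt_eqF.
  have := Phi0 _ s12 mass0.
  have := energy_convex nu rho1 rho2 t10 t20 t12.
  rewrite /Phi ci_cadd// !ci_cscale//.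
  move: (energy _) (energy (cadd nu rho1)) (energy (cadd nu rho2)) (energy nu)
    (ci rho1 D g) (ci rho2 D g) => e e1 e2 e0 c1 c2.
  clear Phi Phi0 s12 mass0 hg r1 r2 s1 s2 bvw sel cg mg bg nu => h1 h2.
  have h3 : 0 <= t1 * (e1 - e0 - c1) + t2 * (e2 - e0 - c2).
    have -> : t1 * (e1 - e0 - c1) + t2 * (e2 - e0 - c2) =
      t1 * e1 + t2 * e2 - (t1 + t2) * e0 - (t1 * c1 + t2 * c2) by ring.
    by rewrite t12 mul1r; lra.
  rewrite -subr_ge0.
  have -> : (e2 - e0 - c2) / m2 - (e1 - e0 - c1) / m1 =
    (t1 * (e1 - e0 - c1) + t2 * (e2 - e0 - c2)) * ((m2 - m1) / (m2 * - m1)).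
    have m1n : m1 != 0 by rewrite lt_eqF.
    have m2n : m2 != 0 by rewrite gt_eqF.
    have m12n : m2 - m1 != 0 by rewrite gt_eqF.
    by rewrite /t1 /t2; field; rewrite ?oppr_eq0 ?m1n ?m2n ?m12n.
  by rewrite mulr_ge0// divr_ge0 ?mulr_ge0 ?oppr_ge0 ?ltW.
have lamD : 0 < cval lam D.
  rewrite cval_lam// setIid /domain; move: per; rewrite /is_periodic; case: bc => // _.
  by rewrite lebesgue_measure_itv/= lte_fin ab -EFinB/= subr_gt0.
(* The slopes on the side of negative mass. The charge -dx shows that [S] is inhabited, and by
   [slope] the charge dx provides an upper bound. *)
pose S := [set x | exists2 rho, supported rho & cval rho D < 0 /\ x = Phi rho / cval rho D].
have Sub rho : supported rho -> 0 < cval rho D -> ubound S (Phi rho / cval rho D).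
  by move=> s r x [rho' s' [r' ->]]; exact: slope.
have hS : has_sup S.
  split; last by exists (Phi lam / cval lam D); apply: Sub => //; exact: supported_lam.
  exists (Phi (cscale (-1) lam) / cval (cscale (-1) lam) D); exists (cscale (-1) lam).
    exact: supported_cscale supported_lam.
  by split => //; rewrite cval_cscale// mulN1r oppr_lt0.
exists (sup S); split => // rho srho.
suff : sup S * cval rho D <= Phi rho.
  rewrite /Phi; move: (energy (cadd nu rho)) (energy nu) (ci rho D g) => x y z.
  by move: (_ * _) => t; clear; lra.
have [r|r|r] := ltgtP (cval rho D) 0.
- rewrite -ler_ndivrMr//; apply: (sup_upper_bound hS); by exists rho.
- by rewrite -ler_pdivlMr//; apply: ge_sup; [case: hS|exact: Sub].
- by rewrite r mulr0; exact: Phi0.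
Qed.

End selection.

(** * Localisation of the selection inequality to a set *)

Section local_selection.
Context {R : realType}.
Local Notation mR := (measurableTypeR R).
Local Notation mu := (@lebesgue_measure R).
Variables (a b : R) (bc : boundary_condition R).
Hypothesis ab : a < b.
Local Notation D := (domain a b bc).
Local Notation lam := (lebesgue_charge a b bc).
Local Notation energy := (energy a b bc).
Variables (nu : {charge set mR -> \bar R}) (g : R -> R) (c : R).
Hypotheses (mg : measurable_fun D g) (bg : bounded_on D g).
Hypothesis sel : forall rho, supported a b bc rho ->
  energy nu + ci rho D g + c * cval rho D <= energy (cadd nu rho).
Implicit Types (N A : set mR) (k p q e : R).

Lemma lebesgue_domain_lty N : measurable N -> N `<=` D -> (mu N < +oo)%E.
Proof.
move=> mN ND; apply: le_lt_trans (domain_fin a b bc).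
by apply: le_measure; rewrite ?inE//; exact: mdomain.
Qed.

(* The competitor is [k dx] on [N] and [nu] elsewhere. *)
Lemma local_inequality N k q e : measurable N -> N `<=` D ->
  (forall x, N x -> `|g x - q| <= e) ->
  tv (cadd nu (cscale 1 lam)) N + tv (cadd nu (cscale (-1) lam)) N
  + (q + c) * cval (cadd (cscale k lam) (copp nu)) N
  - e * tv (cadd (cscale k lam) (copp nu)) N
  <= (`|k + 1| + `|k - 1|) * fine (mu N).
Proof.
move=> mN ND gq; have mD := mdomain a b bc.
pose tau := cadd (cscale k lam) (copp nu); rewrite -/tau.
pose rho : {charge set mR -> \bar R} := crestr0 tau mN.
have rhoE A : measurable A -> cval rho A = cval tau (A `&` N) by exact: cval_crestr0.
have srho : supported a b bc rho.
  move=> A mA; rewrite !rhoE//; last exact: measurableI_domain.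
  by congr (cval tau _); rewrite -setIA (setIidr ND).
have rhoN : cval rho N = cval tau N by rewrite rhoE// setIid.
have rhoD : cval rho D = cval tau N by rewrite rhoE// setIidr.
have tvN : tv rho N = tv tau N.
  by apply: eq_tv => // A mA AN; rewrite rhoE// setIidl.
have ciN : q * cval tau N - e * tv tau N <= ci rho D g.
  rewrite -rhoN -tvN; apply: ci_concentrated => // A mA AD.
  by rewrite !rhoE ?measurableI//= -?setIA ?setIid//; exact: measurableI.
(* Variations are additive over N and its complement; off N the competitor coincides with [nu], so
   those parts cancel from the inequality. *)
have split0 nu' s : tv (cadd nu' (cscale s lam)) D =
    tv (cadd nu' (cscale s lam)) N + tv (cadd nu' (cscale s lam)) (D `\` N).
  rewrite -{1}(setDUK ND) tv_setU//; first exact: measurableD.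
  by rewrite setDE setICA setICr setI0.
have off s : tv (cadd (cadd nu rho) (cscale s lam)) (D `\` N) =
    tv (cadd nu (cscale s lam)) (D `\` N).
  apply: eq_tv; first exact: measurableD.
  move=> A mA AD; rewrite !cval_cadd// rhoE//.
  suff -> : A `&` N = set0 by rewrite cval0 addr0.
  by rewrite -subset0 => x [/AD[]].
have on s : tv (cadd (cadd nu rho) (cscale s lam)) N = `|k + s| * fine (mu N).
  apply: tv_proportional => //; first exact: lebesgue_domain_lty.
  move=> A mA AN; rewrite !(cval_cadd, cval_cscale)// rhoE// setIidl// /tau.
  rewrite !(cval_cadd, cval_cscale)// cval_copp cval_lam_sub//; last exact: subset_trans ND.
  by move: (cval nu A) (fine (mu A)) => x y; ring.
have := sel srho; rewrite rhoD.
have -> : energy nu = tv (cadd nu (cscale 1 lam)) N + tv (cadd nu (cscale 1 lam)) (D `\` N)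
    + (tv (cadd nu (cscale (-1) lam)) N + tv (cadd nu (cscale (-1) lam)) (D `\` N)).
  exact: (congr2 (fun x y => x + y) (split0 nu 1) (split0 nu (-1))).
have -> : energy (cadd nu rho) =
    (`|k + 1| * fine (mu N) + tv (cadd nu (cscale 1 lam)) (D `\` N))
    + (`|k - 1| * fine (mu N) + tv (cadd nu (cscale (-1) lam)) (D `\` N)).
  rewrite -(on 1) -(on (-1)) -(off 1) -(off (-1)).
  exact: (congr2 (fun x y => x + y) (split0 (cadd nu rho) 1) (split0 (cadd nu rho) (-1))).
move: ciN; move: (tv (cadd nu (cscale 1 lam)) N) (tv (cadd nu (cscale (-1) lam)) N)
  (tv (cadd nu (cscale 1 lam)) (D `\` N)) (tv (cadd nu (cscale (-1) lam)) (D `\` N)).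
move: (ci rho D g) (cval tau N) (tv tau N) (`|k + 1|) (`|k - 1|) (fine (mu N)).
move=> x1 x2 x3 x4 x5 x6 x7 x8 x9 x10 h1 h2; lra.
Qed.

(** The competitor p dx is used. Of the two variations in the energy of [nu], one is |p dx - nu|(N),
    and the other is bounded below by p times a signed mass. What is left is (1 - |q + c - p| - e)
    |p dx - nu|(N) <= 0. For p = 1 or -1 the condition |q + c - p| < 1 means 0 < p (q + c) < 2. *)
Lemma selection_rigid N p q e : measurable N -> N `<=` D -> p = 1 \/ p = -1 ->
  (forall x, N x -> `|g x - q| <= e) -> `|q + c - p| + e < 1 ->
  forall A, measurable A -> A `<=` N -> cval nu A = cval (cscale p lam) A.
Proof.
move=> mN ND p1 gq small.
have := local_inequality p mN ND gq.
set tau := cadd (cscale p lam) (copp nu).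
have tauE A : measurable A -> cval tau A = p * cval lam A - cval nu A.
  by move=> mA; rewrite /tau cval_cadd// cval_cscale// cval_copp.
have lamN : cval lam N = fine (mu N) by exact: cval_lam_sub.
have lower : tv tau N + (2 * fine (mu N) - p * cval tau N) <=
    tv (cadd nu (cscale 1 lam)) N + tv (cadd nu (cscale (-1) lam)) N.
  have ntau s : s = - p -> tv (cadd nu (cscale s lam)) N = tv tau N.
    move=> ->; apply/eqP; rewrite eq_le; apply/andP; split.
      have [A [B [mA mB AN BN ->]]] := tv_attained (cadd nu (cscale (- p) lam)) mN.
      have := tv_ge tau mN mB mA BN AN; rewrite !tauE// !cval_cadd// !cval_cscale//.
      by move: (tv tau N) => T; lra.
    have [A [B [mA mB AN BN ->]]] := tv_attained tau mN.
    have := tv_ge (cadd nu (cscale (- p) lam)) mN mB mA BN AN.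
    rewrite !tauE// !cval_cadd// !cval_cscale//.
    by move: (tv _ N) => T; lra.
  have := tv_ge_cval (cadd nu (cscale p lam)) mN mN (@subset_refl _ N).
  have pp : p * p = 1 by case: p1 => ->; rewrite ?mulrNN mul1r.
  have np : `|p| = 1 by case: p1 => ->; rewrite ?normrN normr1.
  have e1 : p * cval (cadd nu (cscale p lam)) N = 2 * fine (mu N) - p * cval tau N.
    rewrite cval_cadd// cval_cscale// tauE// lamN.
    transitivity (2 * fine (mu N) - p * (p * fine (mu N) - cval nu N) + (p * p * fine (mu N) * 2 - 2 * fine (mu N))); first by ring.
    by rewrite pp; ring.
  move=> h; have {}h : 2 * fine (mu N) - p * cval tau N <= tv (cadd nu (cscale p lam)) N.
    by rewrite -e1 (le_trans (ler_norm _))// normrM np mul1r.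
  case: p1 => pE; rewrite pE in ntau h *.
    rewrite (ntau (-1))// addrC; exact: lerD.
  by rewrite (ntau 1) ?opprK//; exact: lerD.
have npp : `|p + 1| + `|p - 1| = 2.
  case: p1 => ->; rewrite ?subrr ?addNr normr0 ?addr0 ?add0r.
    by rewrite ger0_norm//; lra.
  by rewrite -opprD normrN ger0_norm//; lra.
rewrite npp.
have tvtau := tv_ge_cval tau mN mN (@subset_refl _ N).
have tv0 := tv_ge0 tau mN.
have prod : - (`|q + c - p| * tv tau N) <= (q + c - p) * cval tau N.
  rewrite lerNl (le_trans (ler_norm _))// normrN normrM ler_wpM2l//.
move=> main; have tvz : tv tau N = 0.
  apply/eqP; rewrite eq_le tv0 andbT.
  have : (1 - `|q + c - p| - e) * tv tau N <= 0.
    move: lower prod main; move: (`|q + c - p|) (tv tau N) (cval tau N) (fine (mu N))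
      (tv (cadd nu (cscale 1 lam)) N) (tv (cadd nu (cscale (-1) lam)) N).
    by clear tauE tvtau tv0 tau => *; lra.
  by rewrite pmulr_rle0//; move: small; move: (`|_|) => x; lra.
move=> A mA AN; rewrite cval_cscale//; apply/eqP; rewrite eq_sym -subr_eq0 -tauE//.
by rewrite -normr_eq0 eq_le normr_ge0 andbT -tvz tv_ge_cval.
Qed.

(** With nu = p dx on N every term is proportional to the length of N, and dividing by it leaves the
    scalar subgradient inequality W(k) >= W(p) + (q + c)(k - p) - e |k - p|. *)
Lemma selection_range N p q e : measurable N -> N `<=` D -> p = 1 \/ p = -1 ->
  (forall x, N x -> `|g x - q| <= e) -> 0 < fine (mu N) ->
  (forall A, measurable A -> A `<=` N -> cval nu A = cval (cscale p lam) A) ->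
  - e <= p * (q + c) <= 2 + e.
Proof.
move=> mN ND p1 gq muN nuN; set L := fine (mu N) in muN *.
have mNoo := lebesgue_domain_lty mN ND.
have lamA A : measurable A -> A `<=` N -> cval lam A = fine (mu A).
  by move=> mA AN; apply: cval_lam_sub => //; exact: subset_trans ND.
have tvs s : tv (cadd nu (cscale s lam)) N = `|p + s| * L.
  apply: tv_proportional => // A mA AN.
  by rewrite cval_cadd// nuN// !cval_cscale// lamA//; ring.
have tvk k : tv (cadd (cscale k lam) (copp nu)) N = `|k - p| * L.
  apply: tv_proportional => // A mA AN.
  by rewrite cval_cadd// cval_copp nuN// !cval_cscale// lamA//; ring.
have cvk k : cval (cadd (cscale k lam) (copp nu)) N = (k - p) * L.
  by rewrite cval_cadd// cval_copp nuN// !cval_cscale// lamA// -/L; ring.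
have h k : (`|p + 1| + `|p - 1| + (q + c) * (k - p) - e * `|k - p|) * L <=
    (`|k + 1| + `|k - 1|) * L.
  have := local_inequality k mN ND gq; rewrite !tvs tvk cvk -/L.
  by move: (`|_|) (`|_|) (`|_|) (`|_|) (`|_|) => *; rewrite !(mulrDl, mulrBl) -!mulrA; lra.
have {}h k : `|p + 1| + `|p - 1| + (q + c) * (k - p) - e * `|k - p| <= `|k + 1| + `|k - 1|.
  by have := h k; rewrite ler_pM2r.
have n2 : `|2 : R| = 2 by rewrite ger0_norm.
have n3 : `|3 : R| = 3 by rewrite ger0_norm.
(* W equals 2 at both 0 and p, so k = 0 gives the lower bound; W(2 p) = 4, so k = 2 p gives the
   upper one. *)
have := h 0; have := h (2 * p); rewrite !(add0r, sub0r, normrN, normr1).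
case: p1 => ->.
  rewrite subrr normr0 mulr1 mul1r.
  have -> : 2 + 1 = 3 :> R by ring.
  have -> : 2 - 1 = 1 :> R by ring.
  have -> : 1 + 1 = 2 :> R by ring.
  by rewrite n2 n3 normr1; lra.
have -> : 2 * -1 + 1 = -1 :> R by ring.
have -> : 2 * -1 - 1 = -3 :> R by ring.
have -> : 2 * -1 - -1 = -1 :> R by ring.
have -> : -1 + 1 = 0 :> R by ring.
have -> : -1 - 1 = -2 :> R by ring.
rewrite !normrN n2 n3 normr1 normr0 mulN1r.
by lra.
Qed.

End local_selection.

(** * Facets *)

Section slopes.
Context {R : realType}.
Local Notation mR := (measurableTypeR R).
Local Notation mu := (@lebesgue_measure R).
Variables (a b : R) (bc : boundary_condition R).
Hypothesis ab : a < b.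
Implicit Types (v : R -> R) (p x y z : R).

Definition affine v p y z : Prop :=
  exists C, {ae mu, forall x, `]y, z[%classic x -> v x = p * x + C}.

Lemma is_derive_const_slope (w : R -> R) p y z : y < z ->
  (forall x, `]y, z[%classic x -> is_derive x (1 : R) w p) ->
  exists C, forall x, `]y, z[%classic x -> w x = p * x + C.
Proof.
move=> yz dw; pose m := (y + z) / 2.
have ym : y < m by rewrite /m; lra.
have mz : m < z by rewrite /m; lra.
have incr x1 x2 : y < x1 -> x1 <= x2 -> x2 < z -> w x2 - w x1 = p * (x2 - x1).
  move=> yx1 x12 x2z.
  have dx x : x \in `[x1, x2] -> is_derive x (1 : R) w p.
    rewrite in_itv/= => /andP[h1 h2]; apply: dw.
    by rewrite /= in_itv/= (lt_le_trans yx1 h1) (le_lt_trans h2 x2z).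
  have dxo x : x \in `]x1, x2[ -> is_derive x (1 : R) w p.
    by move=> xx; apply: dx; apply: subset_itv_oo_cc xx.
  have cw : {within `[x1, x2], continuous w}.
    apply: derivable_within_continuous => x /dx h.
    exact: (@ex_derive _ _ _ _ _ _ _ h).
  by have [t _ e] := @MVT_segment R w (fun=> p) x1 x2 x12 dxo cw.
exists (w m - p * m) => x; rewrite /= in_itv/= => /andP[yx xz].
have [xm|/ltW mx] := leP x m.
  by have := incr _ _ yx xm mz; rewrite mulrBr; lra.
by have := incr _ _ ym mx xz; rewrite mulrBr; lra.
Qed.

(** One direction is the mean value theorem; in the other the affine function itself is the
    representative, and it has the required one-sided derivatives at the ends. *)
Lemma has_slopeP v p y z : y < z -> has_slope v p y z <-> affine v p y z.
Proof.
move=> yz; split.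
  move=> [w [wv dw _ _]]; have [C HC] := is_derive_const_slope yz dw.
  by exists C; move: wv; apply: aeS => x wvx yxz; rewrite -wvx// HC.
move=> [C HC]; exists (fun x => p * x + C).
have quot x h : h != 0 -> h^-1 * (p * (x + h) + C - (p * x + C)) = p.
  by move=> h0; field.
split.
- by move: HC; apply: aeS => x h /h.
- move=> x _.
  have dC : is_derive x (1 : R) (fun x => p * x + C) (p *: (1 : R) + 0).
    exact: (is_deriveD (is_deriveZ p (is_derive_id x (1 : R))) (is_derive_cst C x 1)).
  by apply: (is_derive_eq dC); rewrite addr0 /GRing.scale/= mulr1.
- apply: cvg_near_cst; near=> h.
  have h0 : 0 < h by near: h; exact: nbhs_right_gt.
  by apply: quot; rewrite gt_eqF.
- apply: cvg_near_cst; near=> h.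
  have h0 : h < 0 by near: h; exact: nbhs_left_lt.
  by apply: quot; rewrite lt_eqF.
Unshelve. all: by end_near. Qed.

(** The overlap has positive measure, hence contains a point where both formulas hold, and the
    constants agree. *)
Lemma affine_union v p y1 z1 y2 z2 : affine v p y1 z1 -> affine v p y2 z2 ->
  Num.max y1 y2 < Num.min z1 z2 -> affine v p (Num.min y1 y2) (Num.max z1 z2).
Proof.
move=> [C1 H1] [C2 H2] ov; have H := aeI H1 H2.
have HE : {ae mu, forall x, `](Num.max y1 y2), (Num.min z1 z2)[%classic x -> C1 = C2}.
  move: H; apply: aeS => x [h1 h2].
  rewrite /= in_itv/= gt_max lt_min => /andP[/andP[x1 x2] /andP[x3 x4]].
  have := h1; have := h2; rewrite /= !in_itv/= x1 x2 x3 x4 => /(_ isT) -> /(_ isT); lra.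
have [x _ C12] := ae_dense HE (lexx _) ov (lexx _).
exists C1; move: H; apply: aeS => t [h1 h2].
rewrite /= in_itv/= gt_min lt_max => tin.
move: ov; rewrite gt_max !lt_min => /andP[/andP[k1 k2] /andP[k3 k4]].
have [t1|t1] := boolP (y1 < t < z1); first by apply: h1; rewrite /= in_itv.
rewrite C12; apply: h2; rewrite /= in_itv/=.
move: t1; rewrite negb_and -!leNgt => /orP[t1|t1].
  move: tin; rewrite ltNge t1/= => /andP[-> _]/=.
  by rewrite (le_lt_trans t1).
move: tin; rewrite [t < z1]ltNge t1/= => /andP[_ ->].
by rewrite (lt_le_trans _ t1).
Qed.

(** The function whose slopes are meant: on the circle, the lift to the universal cover. *)
Definition lifted v : R -> R := if is_periodic bc then periodize a b v else v.

Lemma slope_intervalP v p y z : slope_interval a b bc v p y z <->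
  [/\ y < z, affine (lifted v) p y z & ~~ is_periodic bc -> a <= y /\ z <= b].
Proof.
rewrite /slope_interval /lifted /is_periodic; case: bc => [A B||].
- split; first by move=> [yz [ay zb /(has_slopeP _ _ yz)]].
  by move=> [yz h /(_ isT)[ay zb]]; split => //; split => //; apply/has_slopeP.
- split; first by move=> [yz [ay zb /(has_slopeP _ _ yz)]].
  by move=> [yz h /(_ isT)[ay zb]]; split => //; split => //; apply/has_slopeP.
- split; first by move=> [yz /(has_slopeP _ _ yz)].
  by move=> [yz h _]; split => //; apply/has_slopeP.
Qed.

Lemma affine_lifted v p y z : a <= y -> z <= b ->
  affine (lifted v) p y z <-> affine v p y z.
Proof.
move=> ay zb.
have e x : `]y, z[%classic x -> lifted v x = v x.
  rewrite /= in_itv/= => /andP[yx xz]; rewrite /lifted; case: ifP => // _.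
  rewrite (@periodizeE _ a b v 0)// mulr0 subr0//.
  by rewrite (le_trans ay (ltW yx)) (lt_le_trans xz).
split=> -[C HC]; exists C; move: HC; apply: aeS => x h yxz.
  by rewrite -e// h.
by rewrite e// h.
Qed.

(** [facet] with the slope as a parameter, since only facets of equal slope are compared with one
    another. *)
Definition facet_of v p y z : Prop :=
  [/\ slope_interval a b bc v p y z,
      forall y' z', slope_interval a b bc v p y' z' -> y' <= y -> z <= z' ->
        y' = y /\ z' = z
    & if bc is Periodic then a <= y < b else True].

Lemma facet_of_bounds v p y z : facet_of v p y z -> [/\ a <= y, y < b & y < z].
Proof.
move=> [/slope_intervalP[yz _ h] _]; move: h; rewrite /is_periodic; case: bc => [A B||].
- by move=> /(_ isT)[ay zb] _; rewrite (lt_le_trans yz).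
- by move=> /(_ isT)[ay zb] _; rewrite (lt_le_trans yz).
- by move=> _ /andP[].
Qed.

(** The union of the two intervals is again a slope interval, so maximality forbids it to be larger
    than the facet. *)
Lemma facet_of_absorb v p y z y' z' : facet_of v p y z ->
  slope_interval a b bc v p y' z' -> Num.max y y' < Num.min z z' ->
  y <= y' /\ z' <= z.
Proof.
move=> [/slope_intervalP[yz h hp] mx _] /slope_intervalP[yz' h' hp'] ov.
have [|||e1 e2] := mx (Num.min y y') (Num.max z z').
- apply/slope_intervalP; split.
  + by rewrite gt_min !lt_max yz.
  + exact: affine_union.
  + move=> np; have [ay zb] := hp np; have [ay' zb'] := hp' np.
    by rewrite le_min ge_max ay ay' zb zb'.
- by rewrite ge_min lexx.
- by rewrite le_max lexx.
split.
  by rewrite -e1 ge_min lexx orbT.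
by rewrite -e2 le_max lexx orbT.
Qed.

Lemma facet_of_overlap v p y1 z1 y2 z2 : facet_of v p y1 z1 -> facet_of v p y2 z2 ->
  Num.max y1 y2 < Num.min z1 z2 -> (y1, z1) = (y2, z2).
Proof.
move=> f1 f2 ov.
have [s1 _ _] := f1; have [s2 _ _] := f2.
have [h1 h2] := facet_of_absorb f1 s2 ov.
have [h3 h4] : y2 <= y1 /\ z1 <= z2.
  by apply: (facet_of_absorb f2 s1); rewrite maxC minC.
by congr pair; apply/eqP; rewrite eq_le; apply/andP; split.
Qed.

End slopes.

(** * Uniform continuity of the flux up to the boundary *)

Section within_continuity.
Context {R : realType}.
Variables (a b : R) (g : R -> R).
Hypothesis cg : {within `[a, b], continuous g}.

Lemma within_continuous_dist x e : a <= x <= b -> 0 < e ->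
  exists2 d, 0 < d & forall t, a <= t <= b -> `|t - x| < d -> `|g t - g x| <= e.
Proof.
move=> xab e0; have xab' : `[a, b]%classic x by rewrite /= in_itv.
have := (subspace_continuousP _ _).1 cg x xab'.
move=> /cvgrPdist_le/(_ _ e0)/nbhs_ballP[d /= d0 h].
exists d => // t tab tx; rewrite distrC; apply: (h t).
  by rewrite /ball/= distrC.
by rewrite /= in_itv.
Qed.

(** A Heine argument for the single tolerance 1, chosen below the oscillation 2 of the flux over a
    curved facet. *)
Lemma within_continuous_uniform : exists2 d, 0 < d &
  forall s t, a <= s <= b -> a <= t <= b -> `|s - t| < d -> `|g s - g t| <= 1.
Proof.
pose P (d t : R) := a <= t <= b ->
  forall s, a <= s <= b -> `|s - t| < d -> `|g s - g t| <= 1.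
have : \forall d \near (0 : R)^'+, `[a, b]%classic `<=` P d.
  apply: ((compact_near_coveringP _).1 (@segment_compact R a b)) => x.
  rewrite /= in_itv/= => xab.
  have [d d0 hd] := within_continuous_dist xab (ltac:(lra) : 0 < 1 / 2 :> R).
  exists ([set t | `|t - x| < d / 2], [set e | 0 < e < d / 2]).
    split => /=.
      apply/nbhs_ballP; exists (d / 2) => /=; first by rewrite divr_gt0.
      by move=> t; rewrite /ball/= distrC.
    near=> e; apply/andP; split; near: e; first exact: nbhs_right_gt.
    by apply: nbhs_right_lt; rewrite divr_gt0.
  move=> [t e] /= [tx /andP[e0 ed]] tab s sab st.
  have h1 : `|g t - g x| <= 1 / 2 by apply: hd => //; lra.
  have h2 : `|g s - g x| <= 1 / 2.
    apply: hd => //; have := ler_distD t s x; lra.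
  by have := ler_distD (g x) (g s) (g t); rewrite [`|g x - _|]distrC; lra.
move=> h; have [d [d0 hd]] := filter_ex (filterI (nbhs_right_gt (0 : R)) h).
exists d => // s t sab tab st; by apply: (hd t).
Unshelve. all: by end_near. Qed.

End within_continuity.

(** * Values of the flux at the ends of facets, and the count of facets *)

Section facet_flux.
Context {R : realType}.
Local Notation mR := (measurableTypeR R).
Local Notation mu := (@lebesgue_measure R).
Variables (a b : R) (bc : boundary_condition R).
Hypothesis ab : a < b.
Local Notation I := (`]a, b[%classic : set mR).
Local Notation D := (domain a b bc).
Local Notation lam := (lebesgue_charge a b bc).
Implicit Types (v w f g : R -> R) (nu rho : {charge set mR -> \bar R}).
Implicit Types (A N : set mR) (p x y z : R).

Lemma charge_of_affine v nu p y z : integrable_on_I a b v ->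
  is_derivative_charge a b bc v nu -> a <= y -> z <= b -> affine v p y z ->
  forall A, measurable A -> A `<=` `]y, z[ -> cval nu A = cval (cscale p lam) A.
Proof.
move=> iv dv ay zb [C HC]; have [C0 H0] := derivative_representation ab iv dv.
apply: (@cval_eq_of_cum _ a b bc nu _ y z (C - C0 + p * a - p * cum a b bc lam a)) => //.
move: (aeI HC H0); apply: aeS => x [h h0] yxz; have := h yxz.
move: yxz; rewrite /= in_itv/= => /andP[yx xz].
have ax : a < x by exact: le_lt_trans yx.
have xb : x < b by exact: lt_le_trans zb.
have Ix : I x by rewrite /= in_itv/= ax.
rewrite (h0 Ix) cum_cscale (cum_lamE bc ax xb).
by move: (cum a b bc nu x) (cum a b bc lam a) => s t h1; rewrite mulrDr mulrBr; lra.
Qed.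

Lemma affine_of_charge v nu p y z : integrable_on_I a b v ->
  is_derivative_charge a b bc v nu -> a <= y -> y < z -> z <= b ->
  (forall A, measurable A -> A `<=` `]y, z[ -> cval nu A = cval (cscale p lam) A) ->
  affine v p y z.
Proof.
move=> iv dv ay yz zb nuE; have [C0 H0] := derivative_representation ab iv dv.
pose m := (y + z) / 2.
have ym : y < m by rewrite /m; lra.
have mz : m < z by rewrite /m; lra.
have incr s t : y < s -> s <= t -> t < z ->
    cum a b bc nu t - cum a b bc nu s = p * (t - s).
  move=> ys st tz; have as_ : a <= s by rewrite ltW// (le_lt_trans ay).
  have tb : t < b by exact: lt_le_trans zb.
  have mst : measurable (`]s, t]%classic : set mR) by exact: measurable_itv.
  rewrite (cum_itv _ _ as_ st tb) nuE//.
    by rewrite cval_cscale// -(cum_itv bc lam as_ st tb) (cum_lam bc as_ st tb).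
  move=> x; rewrite /= !in_itv/= => /andP[sx xt].
  by rewrite (lt_trans ys sx) (le_lt_trans xt tz).
exists (C0 + cum a b bc nu m - p * m).
move: H0; apply: aeS => x h; rewrite /= in_itv/= => /andP[yx xz].
rewrite h; last by rewrite /= in_itv/= (le_lt_trans ay yx) (lt_le_trans xz zb).
have [xm|/ltW mx] := leP x m.
  by have := incr _ _ yx xm mz; rewrite mulrBr; lra.
by have := incr _ _ ym mx xz; rewrite mulrBr; lra.
Qed.

Section flux.
Variables (v g : R -> R) (nu : {charge set mR -> \bar R}) (c : R).
Hypotheses (iv : integrable_on_I a b v) (dv : is_derivative_charge a b bc v nu).
Hypotheses (mg : measurable_fun D g) (bg : bounded_on D g).
Hypothesis cg : {within `[a, b], continuous g}.
Hypothesis sel : forall rho, supported a b bc rho ->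
  energy a b bc nu + ci rho D g + c * cval rho D <= energy a b bc (cadd nu rho).

(** [x] may be an end of [y, z]. The bounds 0 and 2 come from the part of ]y, z[ near [x], possibly
    on one side only, and pass to [x] by continuity of [g]. Rigidity, in contrast, works on a full
    neighbourhood of [x], so that a value strictly between them extends the slope to both sides. *)
Lemma flux_dichotomy p x y z : p = 1 \/ p = -1 -> affine v p y z ->
  a <= y -> y < z -> z <= b -> a < x -> x < b -> y <= x -> x <= z ->
  [\/ p * (g x + c) = 0, p * (g x + c) = 2
    | exists y1 z1, [/\ a <= y1, y1 < x, x < z1, z1 <= b & affine v p y1 z1]].
Proof.
move=> p1 va ay yz zb ax xb yx xz; set r := p * (g x + c).
have xab : a <= x <= b by rewrite !ltW.
have itvD y' z' : a <= y' -> z' <= b -> `]y', z'[%classic `<=` D.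
  move=> ay' zb'; apply: subset_trans (@itv_sub_domain _ a b bc).
  move=> t; rewrite /= !in_itv/= => /andP[h1 h2].
  by rewrite (le_lt_trans ay' h1) (lt_le_trans h2 zb').
have range e : 0 < e -> - e <= r <= 2 + e.
  move=> e0; have [d d0 hd] := within_continuous_dist cg xab e0.
  pose y' := Num.max y (x - d); pose z' := Num.min z (x + d).
  have yz' : y' < z' by rewrite /y' /z' gt_max !lt_min yz; lra.
  have ay' : a <= y' by rewrite le_max ay.
  have zb' : z' <= b by rewrite ge_min zb.
  have N1 : `]y', z'[%classic `<=` `]y, z[.
    move=> t; rewrite /= !in_itv/= gt_max lt_min.
    by move=> /andP[/andP[-> _] /andP[-> _]].
  have N2 t : `]y', z'[%classic t -> `|g t - g x| <= e.
    rewrite /= in_itv/= => /andP[h1 h2]; apply: hd.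
      by rewrite ltW ?(le_lt_trans ay')//= ltW// (lt_le_trans h2).
    move: h1 h2; rewrite gt_max lt_min => /andP[_ h1] /andP[_ h2].
    by rewrite ltr_norml; lra.
  have mN : measurable (`]y', z'[%classic : set mR) by exact: measurable_itv.
  apply: (selection_range mg bg sel mN (itvD _ _ ay' zb') p1 N2).
    by rewrite lebesgue_measure_itv/= lte_fin yz' -EFinB/= subr_gt0.
  move=> A mA AN; apply: (charge_of_affine iv dv ay zb va mA).
  exact: subset_trans N1.
have r0 : 0 <= r.
  rewrite leNgt; apply/negP => r0.
  by have := range (- r / 2) ltac:(lra); lra.
have r2 : r <= 2.
  rewrite leNgt; apply/negP => r2.
  by have := range ((r - 2) / 2) ltac:(lra); lra.
have [re|rn0] := eqVneq r 0; first exact: Or31.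
have [re|rn2] := eqVneq r 2; first exact: Or32.
have rgt : 0 < r by rewrite lt_neqAle eq_sym rn0.
have rlt : r < 2 by rewrite lt_neqAle rn2.
apply: Or33.
have small : `|r - 1| < 1 by rewrite ltr_norml; lra.
(* Half of the available margin, so that |r - 1| plus this oscillation stays below 1. *)
have e0 : 0 < (1 - `|r - 1|) / 2 by move: small; move: (`|_|) => s; lra.
have [d d0 hd] := within_continuous_dist cg xab e0.
exists (Num.max a (x - d)), (Num.min b (x + d)).
have y1x : Num.max a (x - d) < x by rewrite gt_max ax/=; lra.
have xz1 : x < Num.min b (x + d) by rewrite lt_min xb/=; lra.
have ay1 : a <= Num.max a (x - d) by rewrite le_max lexx.
have zb1 : Num.min b (x + d) <= b by rewrite ge_min lexx.
split => //.
apply: (affine_of_charge iv dv ay1 (lt_trans y1x xz1) zb1).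
have N2 t : `](Num.max a (x - d)), (Num.min b (x + d))[%classic t ->
    `|g t - g x| <= (1 - `|r - 1|) / 2.
  rewrite /= in_itv/= => /andP[h1 h2]; apply: hd.
    by rewrite ltW ?(le_lt_trans ay1)//= ltW// (lt_le_trans h2).
  move: h1 h2; rewrite gt_max lt_min => /andP[_ h1] /andP[_ h2].
  by rewrite ltr_norml; lra.
apply: (selection_rigid mg bg sel (measurable_itv _) (itvD _ _ ay1 zb1) p1 N2).
have -> : `|g x + c - p| = `|r - 1|.
  rewrite /r; case: p1 => ->; first by rewrite mul1r.
  by rewrite mulN1r -[RHS]normrN; congr (`|_|); ring.
by move: small; move: (`|_|) => s; lra.
Qed.

Lemma facet_flux p y z : p = 1 \/ p = -1 -> facet_of a b bc v p y z -> a < y -> z < b ->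
  (p * (g y + c) = 0 \/ p * (g y + c) = 2) /\ (p * (g z + c) = 0 \/ p * (g z + c) = 2).
Proof.
move=> p1 fv ay zb; have [_ _ yz] := facet_of_bounds fv.
have [si _ _] := fv.
have va : affine v p y z.
  have /slope_intervalP[_ h _] := si.
  by apply/(@affine_lifted R a b bc ab v p y z (ltW ay) (ltW zb)).
have lift y1 z1 : a <= y1 -> y1 < z1 -> z1 <= b -> affine v p y1 z1 ->
    slope_interval a b bc v p y1 z1.
  by move=> ay1 yz1 zb1 h; apply/slope_intervalP; split => //; apply/affine_lifted.
split.
  have [e|e|[y1 [z1 [ay1 y1y yz1 zb1 h]]]] := flux_dichotomy p1 va (ltW ay) yz (ltW zb)
    ay (lt_trans yz zb) (lexx y) (ltW yz); [by left|by right|].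
  have [] := facet_of_absorb fv (lift _ _ ay1 (lt_trans y1y yz1) zb1 h).
    by rewrite gt_max !lt_min yz yz1/= (lt_trans y1y yz) (lt_trans y1y yz1).
  by rewrite leNgt y1y.
have [e|e|[y1 [z1 [ay1 y1z zz1 zb1 h]]]] := flux_dichotomy p1 va (ltW ay) yz (ltW zb)
    (lt_trans ay yz) zb (ltW yz) (lexx z); [by left|by right|].
have [] := facet_of_absorb fv (lift _ _ ay1 (lt_trans y1z zz1) zb1 h).
  by rewrite gt_max !lt_min yz y1z (lt_trans yz zz1) (lt_trans y1z zz1).
by move=> _; rewrite leNgt zz1.
Qed.

Lemma facet_length p y z (d : R) : p = 1 \/ p = -1 -> facet_of a b bc v p y z ->
  a < y -> z < b -> g y <> g z ->
  (forall s t, a <= s <= b -> a <= t <= b -> `|s - t| < d -> `|g s - g t| <= 1) ->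
  d <= z - y.
Proof.
move=> p1 fv ay zb gyz hd; have [_ _ yz] := facet_of_bounds fv.
rewrite leNgt; apply/negP => zyd.
have : `|g z - g y| <= 1.
  apply: hd; first by rewrite !ltW// (lt_trans ay).
    by rewrite !ltW// (lt_trans yz).
  by rewrite gtr0_norm// subr_gt0.
have [hy hz] := facet_flux p1 fv ay zb; rewrite ler_norml => /andP[h1 h2].
by apply: gyz; move: hy hz; case: p1 => -> [hy|hy] [hz|hz]; lra.
Qed.

End flux.

Lemma finite_subset1 (T : Type) (S : set T) : (forall s t, S s -> S t -> s = t) -> finite_set S.
Proof.
move=> h; have [->|/set0P[s Ss]] := eqVneq S set0; first exact: finite_set0.
by apply: (sub_finite_set _ (finite_set1 s)) => t St; exact: h.
Qed.

(* Facets reaching the boundary, or crossing the gluing point of the circle,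
   are at most two for each slope, because facets of one slope do not overlap;
   only interior facets need the flux. *)
Lemma finite_facets v f : BV a b bc v -> subdifferential_selection a b bc v f ->
  finite_set [set yz : R * R | facet a b bc v yz.1 yz.2 /\
                               ~ zero_curvature a b bc f yz.1 yz.2].
Proof.
move=> bv sel; have [iv exv] := bv; have dv := derivative_chargeP exv.
have [g [c [cg hsel]]] := selection_multiplier ab bv sel.
have [mg bg] := continuous_representative_domain ab cg.
have cwg := continuous_representative_within cg.
have [d d0 hd] := within_continuous_uniform cwg.
(* Zero curvature only asks for some continuous representative with equal end values, so its failure
   applies to this [g]; the shift [c] cancels in the difference. *)
pose F p := [set yz : R * R | facet_of a b bc v p yz.1 yz.2 /\ g yz.1 <> g yz.2].
suff finF p : p = 1 \/ p = -1 -> finite_set (F p).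
  apply: (@sub_finite_set _ _ (F 1 `|` F (-1))); last first.
    by rewrite finite_setU; split; apply: finF; [left|right].
  move=> [y z] /= [[p p1 h] nz].
  have gyz : g y <> g z by move=> e; apply: nz; left; exists g.
  by case: p1 => pE; rewrite pE in h; [left|right].
move=> p1.
pose A1 := F p `&` [set yz | yz.1 = a].
pose A2 := F p `&` [set yz | b <= yz.2].
pose A3 := F p `&` [set yz | a < yz.1 /\ yz.2 < b].
have fA1 : finite_set A1.
  apply: finite_subset1 => -[y1 z1] [y2 z2] [[/= f1 _] /= e1] [[/= f2 _] /= e2].
  apply: (facet_of_overlap f1 f2); rewrite e1 e2 in f1 f2 *.
  have [_ _ h1] := facet_of_bounds f1; have [_ _ h2] := facet_of_bounds f2.
  by rewrite gt_max !lt_min h1 h2.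
(* Any two such facets share the points just to the left of b; on the circle their right ends may
   lie beyond b. *)
have fA2 : finite_set A2.
  apply: finite_subset1 => -[y1 z1] [y2 z2] [[/= f1 _] /= e1] [[/= f2 _] /= e2].
  apply: (facet_of_overlap f1 f2).
  have [_ h1 h1'] := facet_of_bounds f1; have [_ h2 h2'] := facet_of_bounds f2.
  by rewrite gt_max !lt_min h1' h2' (lt_le_trans h1 e2) (lt_le_trans h2 e1).
have fA3 : finite_set A3.
  (* The index of the cell of length d containing the left end. Two facets of length at least d
     whose left ends lie in one half-open cell overlap, hence coincide, and there are finitely many
     cells. *)
  pose idx (yz : R * R) := Num.truncn ((yz.1 - a) / d).
  apply: (@sub_finite_set _ _
    (\bigcup_(n in `I_(Num.truncn ((b - a) / d)).+1) (A3 `&` [set yz | idx yz = n]))).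
    move=> [y z] [[/= fyz gyz] [/= ay zb]]; exists (idx (y, z)) => //=.
    have [_ yb _] := facet_of_bounds fyz.
    rewrite ltnS; apply: le_truncn.
    by rewrite ler_pM2r ?invr_gt0// lerD2r ltW.
  apply: bigcup_finite; first exact: finite_II.
  move=> n _; apply: finite_subset1.
  move=> [y1 z1] [y2 z2] [[[/= f1 g1] [/= ay1 zb1]] e1] [[[/= f2 g2] [/= ay2 zb2]] e2].
  have l1 := facet_length iv dv mg bg cwg hsel p1 f1 ay1 zb1 g1 hd.
  have l2 := facet_length iv dv mg bg cwg hsel p1 f2 ay2 zb2 g2 hd.
  have near y : a < y -> idx (y, 0) = n -> n%:R * d <= y - a < n.+1%:R * d.
    move=> ay <-; rewrite /idx/= -ler_pdivlMr// -ltr_pdivrMr//.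
    by apply: truncn_itv; rewrite divr_ge0// ?subr_ge0 ltW.
  have := near _ ay1 e1; have := near _ ay2 e2.
  rewrite -natr1 mulrDl mul1r; move: (n%:R * d) => k h2 h1.
  apply: (facet_of_overlap f1 f2).
  by rewrite gt_max !lt_min; lra.
apply: (@sub_finite_set _ _ (A1 `|` A2 `|` A3)); last by rewrite !finite_setU.
move=> [y z] [/= fyz gyz]; have [ay _ _] := facet_of_bounds fyz.
have [zb|bz] := ltP z b; last by left; right.
move: ay; rewrite le_eqVlt => /predU1P[ay|ay]; first by left; left; split.
by right.
Qed.

End facet_flux.

Theorem theorem4p1 (R : realType) (a b T : R) (hab : a < b) (hT : 0 < T)
    (bc : boundary_condition R) (u0 : R -> R) (hu0 : BV a b bc u0)
    (u Om : R -> R -> R) (hu : solution a b T bc u Om)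
    (hinit : initial_value a b T u u0) :
  {ae (@lebesgue_measure R), forall t : R, 0 < t < T ->
    finite_set [set yz : R * R | facet a b bc (u t) yz.1 yz.2 /\
                                 ~ zero_curvature a b bc (Om t) yz.1 yz.2]}.
Proof.
have [[_ [M hBV]] _ _ hsel _] := hu.
move: (aeI hBV hsel); apply: aeS => t [h1 h2] t0T.
have Jt : `]0, T[%classic t by rewrite /= in_itv.
by have [bvu _] := h1 Jt; exact: (finite_facets hab bvu (h2 Jt)).
Qed.
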